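(* Let $n\ge 1$ be an odd integer and let $(W_n,S_E)$ be an edge-signed map on the $n$-wheel $W_n$ such that $S_E(v)=-S_E(-v)$ for each pair $v,-v$ of antipodal vertices of $med(W_n)$. Then $L(W_n,S_E)$ is $3$-antipodally symmetric.
   Context: Maps. A map $G=(V,E,F)$ is (the image of) an embedding in $\mathbb{S}^2$ of a connected finite planar graph (loops and multiple edges allowed). $G^*$ is its geometric dual. An edge-signed map $(G,S_E)$ is a map with a function $S_E:E\to\{+,-\}$. The $n$-wheel $W_n$ is the plane graph consisting of an $n$-cycle (a loop if $n=1$, two parallel edges if $n=2$) and a center joined to each vertex of the cycle. Medial map. $med(G)$ is the 4-regular map with one vertex on each edge of $G$, two vertices being joined when the corresponding edges are consecutive on a face of $G$. Faces of $med(G)$ containing a vertex of $G$ are colored black, those containing a vertex of $G^*$ white. For a vertex $v$ of $med(G)$ lying on an edge $e$ of $G$ we write $S_E(v)=S_E(e)$. Antipodal vertices. Let $\alpha_n:\mathbb{S}^n\to\mathbb{S}^n$, $x\mapsto -x$. It is known that for odd $n$ the map $W_n$ is antipodally self-dual, i.e. it can be drawn in $\mathbb{S}^2$ so that $\alpha_2(W_n)=W_n^*$, and that then $med(W_n)$ is drawn with $\alpha_2(med(W_n))=med(W_n)$. The antipodal pairs of vertices of $med(W_n)$ are the pairs $v$, $-v=\alpha_2(v)$ in this drawing. Links. $D(G,S_E)$ is the link diagram on $\mathbb{S}^2$ with shadow $med(G)$; the crossing on an edge $e$ has sign $S_E(e)$, where for an observer in a black face at a crossing, looking at the crossing (from outside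 the sphere), a positive crossing is one where the strand on the observer's left passes over the one on the right, a negative crossing is the opposite. $L(G,S_E)$ is the link represented by $D(G,S_E)$ in $\mathbb{R}^3\subset\mathbb{S}^3=\mathbb{R}^3\cup\{\infty\}$. Two links are equivalent if an orientation-preserving homeomorphism of the ambient space maps one onto the other; $[L]$ is the class of links equivalent to $L$. A link $L$ is $3$-antipodally symmetric if there is $\hat L\in[L]$, $\hat L\subset\mathbb{S}^3$, with $\alpha_3(\hat L)=\hat L$. *)

(* Defs.v *)
From HB Require Import structures.
From mathcomp Require Import all_boot all_order all_algebra.
From mathcomp.multinomials Require Import freeg.
From mathcomp Require Import all_classical all_reals all_analysis.
From mathcomp Require Import ring lra.

Set Implicit Arguments.
Unset Strict Implicit.
Unset Printing Implicit Defensive.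

Import Order.TTheory GRing.Theory Num.Theory.
Import numFieldNormedType.Exports.

Local Open Scope classical_set_scope.
Local Open Scope ring_scope.

Section SingularHomology.
Variable R : realType.

Definition simplex k : set 'rV[R]_k.+1 :=
  [set x | (forall j, 0 <= x 0 j) /\ \sum_j x 0 j = 1].
Arguments simplex : clear implicits.

Definition face_row k (i : 'I_k.+2) (x : 'rV[R]_k.+1) : 'rV[R]_k.+2 :=
  \row_j (if unlift i j is Some j' then x 0 j' else 0).

Lemma face_row_simplex k (i : 'I_k.+2) (x : simplex k) :
  face_row i (val x) \in simplex k.+1.
Proof.
case: x => x /= /set_mem[x0 x1]; apply/mem_set; split=> [j|].
  by rewrite mxE; case: unliftP.
rewrite (bigD1_ord i) //= mxE unlift_none add0r -[RHS]x1.
by apply: eq_bigr => j _; rewrite mxE liftK.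
Qed.

Definition face k (i : 'I_k.+2) (x : simplex k) : simplex k.+1 :=
  SigSub (face_row_simplex i x).

Lemma face_row_continuous k (i : 'I_k.+2) : continuous (@face_row k i).
Proof.
move=> x A [P Px PA].
exists (fun a b => P a (fintype.lift i b)) => [a b|y Py].
  by have := Px a (fintype.lift i b); rewrite mxE liftK (ord1 a).
apply: PA => a b; rewrite mxE (ord1 a).
case: (unliftP i b) => [b' ->|bi]; first exact: Py.
have := nbhs_singleton (Px 0 i); by rewrite mxE unlift_none bi.
Qed.

Lemma face_continuous k (i : 'I_k.+2) : continuous (@face k i).
Proof.
apply: continuous_comp_initial => x.
apply: (@continuous_comp _ _ _ (fun y : simplex k => val y) (face_row i)).
  exact: initial_continuous.
exact: face_row_continuous.
Qed.

HB.instance Definition _ k (i : 'I_k.+2) :=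
  isContinuous.Build _ _ (@face k i) (@face_continuous k i).

Definition singular k (X : topologicalType) : choiceType :=
  continuousType (simplex k) X.

Definition chain k (X : topologicalType) := {freeg (singular k X) / int}.

Definition boundary k (X : topologicalType) (c : chain k.+1 X) : chain k X :=
  fglift (fun s : singular k.+1 X =>
    \sum_(i < k.+2)
      (<< (-1) ^+ i *g ((s : continuousType _ _) \o face i : singular k X) >>
        : {freeg (singular k X) / int})) c.

Definition pushforward k (X Y : topologicalType) (f : continuousType X Y)
    (c : chain k X) : chain k Y :=
  fglift (fun s : singular k X =>
    (<< (f \o (s : continuousType _ _) : singular k Y) >>
      : {freeg (singular k Y) / int})) c.

End SingularHomology.

Section Sphere.
Variable R : realType.

Definition sqnorm k (x : 'rV[R]_k) : R := \sum_j x 0 j ^+ 2.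

Definition sphere k : set 'rV[R]_(k + 1) := [set x | sqnorm x = 1].

Definition S3 : topologicalType := sphere (k := 3).

Lemma antipode_subproof (p : S3) : - val p \in sphere (k := 3).
Proof.
case: p => p /= /set_mem p1; apply/mem_set; rewrite /sphere /= -[RHS]p1.
by apply: eq_bigr => j _; rewrite mxE sqrrN.
Qed.

Definition antipode (p : S3) : S3 := SigSub (antipode_subproof p).

(* Inverse stereographic projection from the last unit vector, the point at
   infinity of R^3. It is the identity on the unit 2-sphere (the equator), and
   x |-> - x on S3 corresponds to x |-> - x / |x|^2 on R^3 minus the origin. *)
Definition stereo_row (x : 'rV[R]_3) : 'rV[R]_(3 + 1) :=
  row_mx ((2 / (sqnorm x + 1)) *: x)
         (((sqnorm x - 1) / (sqnorm x + 1))%:M).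

Lemma stereo_subproof (x : 'rV[R]_3) : stereo_row x \in sphere (k := 3).
Proof.
apply/mem_set; rewrite /sphere /= /sqnorm big_split_ord /= big_ord1.
under eq_bigr => j _ do rewrite /stereo_row row_mxEl mxE exprMn.
rewrite -mulr_sumr /stereo_row row_mxEr mxE eqxx mulr1n -/(sqnorm x).
have : sqnorm x + 1 != 0.
  by rewrite gt_eqF// ltr_pwDr// sumr_ge0// => j _; rewrite sqr_ge0.
by move=> h; field.
Qed.

Definition stereo (x : 'rV[R]_3) : S3 := SigSub (stereo_subproof x).

(* f acts as the identity on H_3(S^3; Z), which is infinite cyclic. *)
Definition orientation_preserving (f : continuousType S3 S3) : Prop :=
  forall c : chain R 3 S3, boundary c = 0 ->
    exists b : chain R 4 S3, pushforward f c - c = boundary b.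

Definition link_equivalent (L L' : set S3) : Prop :=
  exists f g : continuousType S3 S3,
    [/\ cancel f g, cancel g f, orientation_preserving f & f @` L = L'].

Definition antipodally_symmetric (L : set S3) : Prop :=
  exists2 L' : set S3, link_equivalent L L' & antipode @` L' = L'.

End Sphere.

(* A map given by its rotation system. The darts (e, false) and (e, true) are
   the two orientations of the edge e; [rot d] is the dart that follows d
   counterclockwise, seen from outside the sphere, around the vertex from which
   d starts. *)
Record cmap := CMap {
  edge : finType;
  rot : edge * bool -> edge * bool;
  rot_inj : injective rot
}.

Definition dart (G : cmap) : Type := (edge G * bool)%type.

Section LinkOfMap.
Variables (R : realType) (G : cmap).

(* The medial map has one vertex on each edge of G and one edge for each corner
   of G. The corner between d and [rot d] is indexed by d; in a drawing [med],
   [med d] : [0, 1] -> S^2 runs along the medial edge cutting that corner, from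
   the medial vertex on the edge of d to the one on the edge of [rot d]. *)
Definition med_vertex (med : dart G -> R -> 'rV[R]_3) (e : edge G) : 'rV[R]_3 :=
  med (e, false) 0.

(* The four ends of medial edges at the medial vertex on e are the starts of
   med (e, false) and med (e, true), which are opposite to each other, and the
   ends of the two curves med d with rot d = (e, false) or (e, true). For an
   observer in the black face around the vertex from which (e, b) starts,
   looking at the crossing, the end on the left is the start of med (e, b) and
   the end on the right is the end of med d with rot d = (e, b). So, for either
   black face, the strand on the left consists of the two starts and the strand
   on the right of the two ends.

   A link represented by the diagram is the diagram with its points pushed
   radially: h d t is the distance to the origin of the point above med d t,
   and l e, r e are those of the left and right strands at the crossing on e.
   From outside the sphere, the strand farther from the origin passes over.
   [S e] is true when the sign of e is +. *)
Definition represents (S : edge G -> bool) (med : dart G -> R -> 'rV[R]_3)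
    (L : set 'rV[R]_3) : Prop :=
  exists (l r : edge G -> R) (h : dart G -> R -> R),
    [/\ forall d, {within `[0, 1], continuous (h d)},
        forall d t, t \in `[0, 1] -> 0 < h d t,
        forall d : dart G, h d 0 = l d.1 /\ h d 1 = r (rot d).1,
        forall e, if S e then r e < l e else l e < r e &
        L = [set x | exists d t, t \in `[0, 1] /\ x = h d t *: med d t]].

End LinkOfMap.

Section Wheel.
Variable n : nat.

(* [inl i] is the spoke from the center to the i-th rim vertex v_i, and
   [inr i] is the rim edge from v_i to v_(i+1), indices being modulo n; these
   are the orientations with boolean [false]. The v_i are numbered
   counterclockwise around the center. *)
Definition wheel_rot (d : ('I_n + 'I_n) * bool) : ('I_n + 'I_n) * bool :=
  match d with
  | (inl i, false) => (inl (ordS i), false)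
  | (inl i, true) => (inr (ord_pred i), true)
  | (inr i, true) => (inr (ordS i), false)
  | (inr i, false) => (inl i, true)
  end.

Lemma wheel_rot_inj : injective wheel_rot.
Proof.
pose inv (d : ('I_n + 'I_n) * bool) : ('I_n + 'I_n) * bool :=
  match d with
  | (inl i, false) => (inl (ord_pred i), false)
  | (inr i, true) => (inl (ordS i), true)
  | (inr i, false) => (inr (ord_pred i), true)
  | (inl i, true) => (inr i, false)
  end.
by apply: (can_inj (g := inv)) => -[[i|i] []] /=; rewrite ?ordSK ?ord_predK.
Qed.

Definition wheel : cmap := CMap wheel_rot_inj.

Variable R : realType.

(* Longitude a / n and height z on the cylinder x^2 + y^2 = 1, projected
   radially onto the unit sphere. *)
Definition sph (a z : R) : 'rV[R]_3 :=
  (Num.sqrt (1 + z ^+ 2))^-1 *: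
    \row_j [:: cos (a / n%:R); sin (a / n%:R); z]`_j.

(* W_n is drawn with its center at the north pole, the i-th spoke on the
   meridian of longitude 2 pi i / n and its rim on the parallel z = -1. For odd
   n the antipodal drawing is W_n^*: center at the south pole, rim on z = 1 and
   spokes at the longitudes pi (2 i + 1) / n. Each edge meets its dual edge
   once, and these are the vertices of the medial map: z = 1 on spokes and
   z = -1 on rim edges. The medial edges are graphs over intervals of
   longitudes: a cycle with z >= 1 through the spokes, a cycle with z <= -1
   through the rim edges, and a zigzag with -1 <= z <= 1 between them. With
   north up and east to the right, arcs start north-east and south-west and end
   north-west and south-east at spokes; at rim edges, they start north-west and
   south-east and end north-east and south-west. *)
Definition wheel_med (d : dart wheel) (t : R) : 'rV[R]_3 :=
  match d with
  | (inl i, false) => sph (2 * pi * i%:R + 2 * pi * t) (1 + 4 * t * (1 - t))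
  | (inl i, true) => sph (2 * pi * i%:R - pi * t) (1 - 2 * t)
  | (inr i, true) =>
      sph (2 * pi * i%:R + pi + 2 * pi * t) (- 1 - 4 * t * (1 - t))
  | (inr i, false) => sph (2 * pi * i%:R + pi - pi * t) (- 1 + 2 * t)
  end.

Lemma sph_sphere a z : sqnorm (sph a z) = 1.
Proof.
rewrite /sqnorm; under eq_bigr => j _ do rewrite 2!mxE exprMn.
rewrite -mulr_sumr exprVn sqr_sqrtr ?addr_ge0 ?sqr_ge0//.
rewrite !big_ord_recl big_ord0 /= addr0 addrA cos2Dsin2 mulVf//.
by rewrite gt_eqF// ltr_pwDl// sqr_ge0.
Qed.

Lemma sph_modn (k : nat) c z : (0 < n)%N ->
  sph (2 * pi * (k %% n)%:R + c) z = sph (2 * pi * k%:R + c) z.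
Proof.
move=> n0; have nz : n%:R != 0 :> R by rewrite pnatr_eq0 -lt0n.
have E : (2 * pi * k%:R + c) / n%:R
    = (2 * pi * (k %% n)%:R + c) / n%:R + pi *+ 2 *+ (k %/ n) :> R.
  rewrite {1}(divn_eq k n) natrD natrM -[pi *+ 2 *+ _]mulr_natr mulr2n.
  by field.
by rewrite /sph E (periodicn (@cosD2pi R)) (periodicn (@sinD2pi R)).
Qed.

Lemma sphDn a z : (0 < n)%N -> sph (a + 2 * pi * n%:R) z = sph a z.
Proof.
move=> n0; have nz : n%:R != 0 :> R by rewrite pnatr_eq0 -lt0n.
have E : (a + 2 * pi * n%:R) / n%:R = a / n%:R + pi *+ 2 :> R.
  by rewrite mulr2n; field.
by rewrite /sph E cosD2pi sinD2pi.
Qed.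

Lemma sphN a z : (0 < n)%N -> - sph a z = sph (a + pi * n%:R) (- z).
Proof.
move=> n0; have nz : n%:R != 0 :> R by rewrite pnatr_eq0 -lt0n.
have E : (a + pi * n%:R) / n%:R = a / n%:R + pi :> R by field.
rewrite /sph E sqrrN -scalerN; congr (_ *: _).
apply/rowP => j; rewrite !mxE cosDpi sinDpi.
by case: j => [[|[|[|]]]].
Qed.

Lemma wheel_med_start e : wheel_med (e, true) 0 = med_vertex wheel_med e.
Proof. by case: e => i; rewrite /med_vertex /=; congr sph; ring. Qed.

Lemma wheel_med_end d : wheel_med d 1 = med_vertex wheel_med (rot d).1.
Proof.
have n0 : (0 < n)%N by case: d => [[i|i] _]; apply: leq_ltn_trans (ltn_ord i).
case: d => [[i|i] []]; rewrite /med_vertex /=.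
- rewrite -(addrA (2 * pi * _)) sph_modn // -(sphDn _ _ n0); congr sph; last by ring.
  have -> : (i + n).-1%:R = i%:R + n%:R - 1 :> R.
    by apply/eqP; rewrite eq_sym subr_eq natr1 -natrD prednK // addn_gt0 n0 orbT.
  by ring.
- by rewrite sph_modn //; congr sph; rewrite -?natr1; ring.
- by rewrite -!(addrA (2 * pi * _)) sph_modn //; congr sph; rewrite -?natr1; ring.
- by congr sph; ring.
Qed.

Lemma wheel_med_antipodal (d : dart wheel) : odd n ->
  exists d', forall t, - wheel_med d t = wheel_med d' t.
Proof.
move=> nodd; have n0 : (0 < n)%N by case: n nodd.
have nE : n%:R = 1 + 2 * n./2%:R :> R.
  by rewrite -[in LHS](odd_double_half n) nodd natrD -mul2n natrM.
case: d => [[i|i] b].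
- exists (inr (Ordinal (ltn_pmod (i + n./2) n0)), ~~ b) => t.
  case: b; rewrite /wheel_med /negb sphN // -!(addrA (2 * pi * _)) sph_modn //; congr sph;
    rewrite ?natrD ?nE; ring.
- exists (inl (Ordinal (ltn_pmod (i + n./2.+1) n0)), ~~ b) => t.
  case: b; rewrite /wheel_med /negb sphN // sph_modn //; congr sph;
    rewrite ?natrD ?nE -?natr1; ring.
Qed.

End Wheel.

(* Main.v *)
Require Import Defs.
From HB Require Import structures.
From mathcomp Require Import all_boot all_order all_algebra.
From mathcomp.multinomials Require Import freeg.
From mathcomp Require Import all_classical all_reals all_analysis.
From mathcomp Require Import zify ring lra.

(** Write a point of R^3 minus the origin as exp(s) u with |u| = 1. The antipode
    of S^3 is then (s, u) |-> (- s, - u). Over the point u = med d t of the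
    diagram the link sits at log-height a d t, and the antipodal arc of d is an
    arc d'. Since the antipode carries left strands to left strands, opposite
    signs at antipodal crossings say precisely that replacing a d by the
    antisymmetric height (a d - a d') / 2 does not exchange the strands at any
    crossing. So over each point of the diagram the required change of height,
    which concerns at most two points, is induced by an increasing affine map
    s |-> exp(A) s + B. Tietze's theorem extends A and B from the diagram to
    all directions, and the resulting radial homeomorphism of S^3 is homotopic
    to the identity through s |-> exp(t A) s + t B, hence acts trivially on
    H_3. *)

Set Implicit Arguments.
Unset Strict Implicit.
Unset Printing Implicit Defensive.

Import Order.TTheory GRing.Theory Num.Theory.
Import numFieldNormedType.Exports.

Local Open Scope classical_set_scope.
Local Open Scope ring_scope.

(** * Coordinatewise continuity and the cancellation behind the prism identity *)

Lemma continuous_rV (T : topologicalType) (R : numFieldType) k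
    (f : T -> 'rV[R]_k) :
  (forall j, continuous (fun x => f x 0 j)) -> continuous f.
Proof.
move=> cf x A [P Pfx PA].
have : \forall y \near x, forall j, P 0 j (f y 0 j).
  by apply: filter_forall => j; exact: cf (Pfx 0 j).
by apply: filterS => y Py; apply: PA => i j; rewrite (ord1 i).
Qed.

(* The combinatorial core of the prism identity: A i j is the signed j-th face of
   the i-th simplex of the prism. *)
Lemma sum_prism_faces (V : zmodType) K (A B : nat -> nat -> V) (Q : nat -> V) :
  (forall i j, (j < i)%N -> (i <= K)%N -> A i j = - B i.-1 j) ->
  (forall i j, (i.+1 < j)%N -> (j <= K.+1)%N -> A i j = - B i j.-1) ->
  (forall i, (i <= K)%N -> A i i = Q i) ->
  (forall i, (i <= K)%N -> A i i.+1 = - Q i.+1) ->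
  \sum_(i < K.+1) \sum_(j < K.+2) A i j =
    Q 0 - Q K.+1 - \sum_(i < K) \sum_(j < K.+1) B i j.
Proof.
move=> Alt Agt Aii AiS.
rewrite -(big_mkord xpredT (fun i => \sum_(j < K.+2) A i j)).
rewrite -(big_mkord xpredT (fun i => \sum_(j < K.+1) B i j)).
(* Row [i] splits at the diagonal: the entries [j = i] and [j = i.+1] give a telescoping difference,
   the others fall into a lower and an upper triangle of entries of [B]. *)
have row i : (0 <= i < K.+1)%N -> \sum_(j < K.+2) A i j =
    (Q i - Q i.+1) + - \sum_(0 <= j < i) B i.-1 j
      + - \sum_(i.+1 <= j < K.+1) B i j.
  move=> /andP[_ iK].
  rewrite -(big_mkord xpredT (A i)) (@big_cat_nat _ _ _ i)//=; last by lia.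
  rewrite (@big_cat_nat _ _ _ i.+2 i)//=; last by lia.
  rewrite big_nat_recr//= big_nat1 Aii// AiS//.
  rewrite addrCA -!addrA; congr (_ + (_ + _)).
  congr (_ + _).
    by rewrite -sumrN; apply: eq_big_nat => j /andP[_ ji]; rewrite Alt.
  by rewrite big_add1 -sumrN /=; apply: eq_big_nat => j /andP[ij jK]; rewrite Agt.
rewrite (eq_big_nat _ _ row) !big_split/= !sumrN -addrA; congr (_ + _).
  by rewrite -[RHS]opprB -telescope_sumr// sumrB opprB.
(* The lower triangle has an empty row [i = 0] and the upper one an empty row [i = K]. Without them
   the two fill the whole rectangle. *)
have -> : \sum_(0 <= i < K.+1) \sum_(0 <= j < i) B i.-1 j =
    \sum_(0 <= i < K) \sum_(0 <= j < i.+1) B i j.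
  by rewrite big_nat_recl// [X in X + _]big_geq// add0r.
have -> : \sum_(0 <= i < K.+1) \sum_(i.+1 <= j < K.+1) B i j =
    \sum_(0 <= i < K) \sum_(i.+1 <= j < K.+1) B i j.
  by rewrite [LHS]big_nat_recr//= [X in _ + X = _]big_geq// addr0.
rewrite -opprD -big_split/=; congr (- _); apply: eq_big_nat => i /andP[_ iK].
by rewrite -(big_mkord xpredT (B i)) [RHS](@big_cat_nat _ _ _ i.+1)//= ltnW.
Qed.

(** * Homotopy invariance of singular homology *)

Section PrismOperator.
Variable R : realType.

(* The map of simplices acting on vertices by th; inord sends values of th
   greater than b to the vertex 0. *)
Definition simp_row a b (th : nat -> nat) (x : 'rV[R]_a.+1) : 'rV[R]_b.+1 :=
  \row_j \sum_(m < a.+1 | inord (th m) == j) x 0 m.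

Lemma simp_row_simplex a b (th : nat -> nat) (x : @simplex R a) :
  simp_row b th (val x) \in @simplex R b.
Proof.
case: x => x /= /set_mem[x0 x1]; apply/mem_set; split=> [j|].
  by rewrite mxE sumr_ge0.
rewrite -[RHS]x1; under eq_bigr => j _ do rewrite mxE.
by rewrite [RHS](partition_big (fun m : 'I_a.+1 => inord (th m) : 'I_b.+1) xpredT).
Qed.

Definition simp_map a b th (x : @simplex R a) : @simplex R b :=
  SigSub (simp_row_simplex b th x).

Lemma simplex_coord_continuous a (j : 'I_a.+1) :
  continuous (fun x : @simplex R a => val x 0 j).
Proof.
move=> x; apply: (@continuous_comp _ _ _ (fun y : @simplex R a => val y)
  (fun M : 'rV[R]_a.+1 => M 0 j)).
  exact: initial_continuous.
exact: coord_continuous.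
Qed.

Lemma simp_map_continuous a b th : continuous (@simp_map a b th).
Proof.
apply: continuous_comp_initial; apply: continuous_rV => j.
have -> : (fun x : @simplex R a => (val \o simp_map b th) x 0 j) =
    (fun x : @simplex R a => \sum_(m < a.+1 | inord (th m) == j) val x 0 m).
  by apply/funext => x; rewrite /= mxE.
apply: continuous_big => [|i _]; first exact: add_continuous.
exact: simplex_coord_continuous.
Qed.

Lemma simp_map_id a th (x : @simplex R a) :
  (forall m, (m <= a)%N -> th m = m) -> simp_map a th x = x.
Proof.
move=> thE; apply: val_inj; apply/rowP => j; rewrite mxE.
have E (m : 'I_a.+1) : inord (th m) = m.
  have := ltn_ord m; rewrite ltnS => /thE ->.
  exact: inord_val.
by under eq_bigl => m do rewrite E; rewrite big_pred1_eq.
Qed.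

(** The values of [et] must be in range for [inord] to keep them; those of [th] are truncated in the
    same way on both sides. *)
Lemma simp_map_comp a b c th et (x : @simplex R a) :
  (forall m, (m <= a)%N -> (et m <= b)%N) ->
  simp_map c th (simp_map b et x) = simp_map c (th \o et) x.
Proof.
move=> etb; apply: val_inj; apply/rowP => j; rewrite !mxE.
under eq_bigr => m _ do rewrite mxE.
rewrite [RHS](partition_big (fun m : 'I_a.+1 => inord (et m) : 'I_b.+1)
  (fun m => inord (th m) == j))/=; last first.
  by move=> m /eqP<-; rewrite inordK// ltnS etb// -ltnS.
apply: eq_bigr => m /eqP mj; apply: eq_bigl => i.
apply/eqP/andP => [im|[_ /eqP//]]; split; last by rewrite im.
have := ltn_ord i; rewrite ltnS => /etb eti.
by rewrite -mj -im /= inordK.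
Qed.

(** On vertices a face inclusion is the map that skips [i]. This reduces identities between faces to
    arithmetic on vertex numbers. *)
Lemma face_simp_map a (i : 'I_a.+2) (x : @simplex R a) :
  face i x = simp_map a.+1 (bump i) x.
Proof.
apply: val_inj; apply/rowP => j; rewrite !mxE.
have E (m : 'I_a.+1) : inord (bump i m) = fintype.lift i m.
  by apply: val_inj; rewrite /= inordK// /bump; case: leqP; have := ltn_ord m; lia.
case: unliftP => [j' ->|->].
  rewrite (big_pred1 j')// => m /=; rewrite E.
  by rewrite (inj_eq lift_inj).
by rewrite big1// => m; rewrite E eq_sym (negbTE (neq_lift _ _)).
Qed.

(** The time coordinate of a prism cell: the affine function that is 0 on the vertices before [t]
    and 1 on the others. *)
Definition tail_sum a (t : nat) (x : @simplex R a) : R :=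
  \sum_(m < a.+1 | (t <= m)%N) val x 0 m.

Lemma tail_sum_continuous a t : continuous (@tail_sum a t).
Proof.
apply: continuous_big => [|i _]; first exact: add_continuous.
exact: simplex_coord_continuous.
Qed.

Lemma tail_sum_simp_map a b th t u (x : @simplex R a) :
  (forall m, (m <= a)%N -> (th m <= b)%N /\ (t <= th m)%N = (u <= m)%N) ->
  tail_sum t (simp_map b th x) = tail_sum u x.
Proof.
move=> tu; rewrite /tail_sum.
under eq_bigr => m _ do rewrite mxE.
rewrite [RHS](partition_big (fun m : 'I_a.+1 => inord (th m) : 'I_b.+1)
  (fun m : 'I_b.+1 => (t <= m)%N))/=.
  apply: eq_bigr => m tm; apply: eq_bigl => i.
  have := ltn_ord i; rewrite ltnS => /tu[thb tui].
  by rewrite andb_idl// => /eqP im; rewrite -tui -[th i](@inordK b)// im.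
by move=> i; have := ltn_ord i; rewrite ltnS => /tu[thb <-]; rewrite inordK.
Qed.

Lemma tail_sum0 a (x : @simplex R a) : tail_sum 0 x = 1.
Proof. by have /set_mem[] := valP x. Qed.

Lemma tail_sum_oob a t (x : @simplex R a) : (a < t)%N -> tail_sum t x = 0.
Proof.
move=> at_; rewrite /tail_sum big_pred0// => m; apply/negbTE.
by rewrite -ltnNge; apply: leq_trans at_.
Qed.

Variables (X Y : topologicalType) (H : X * R -> Y).
Hypothesis cH : continuous H.

Lemma prism_cell_subproof a b th t (s : singular R b X) :
  continuous (fun x : @simplex R a =>
    H ((s : continuousType _ _) (simp_map b th x), tail_sum t x)).
Proof.
have cs : continuous ((s : continuousType _ _) \o @simp_map a b th).
  by move=> x; apply: continuous_comp; [exact: simp_map_continuous|exact: cts_fun].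
move=> x; apply: (@continuous_comp _ _ _
  (fun x : @simplex R a =>
    ((s : continuousType _ _) (simp_map b th x), tail_sum t x)) H).
  exact: (cvg_pair (cs x) (@tail_sum_continuous a t x)).
exact: cH.
Qed.

(* For th = unbump i, t = i.+1 and a = b.+1 this is the i-th simplex
   [v_0 .. v_i w_i .. w_b] of the prism over s, where v lies at time 0 and w at
   time 1. For th = id it is s at time 1 if t = 0 and at time 0 if t > b. *)
Definition prism_cell a b th t (s : singular R b X) : singular R a Y :=
  mkcts (@prism_cell_subproof a b th t s).

Definition prism k (s : singular R k X) : chain R k.+1 Y :=
  \sum_(i < k.+1) << (-1) ^+ i *g prism_cell k.+1 (unbump i) i.+1 s >>.

End PrismOperator.

(** Deleting vertex [j] moves the first vertex at time 1 down by one exactly when [j] lies before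
    it. *)
Lemma prism_cell_face (R : realType) (X Y : topologicalType) (H : X * R -> Y)
    (cH : continuous H) a b th t (s : singular R b X) (j : 'I_a.+2) :
  (forall m, (m <= a.+1)%N -> (th m <= b)%N) ->
  ((prism_cell cH a.+1 th t s : continuousType _ _) \o face j : singular R a Y) =
  prism_cell cH a (th \o bump j) (t - (j < t))%N s.
Proof.
move=> thb; apply/continuousEP => x /=; rewrite /mkcts; congr (H (_, _)).
  rewrite face_simp_map simp_map_comp// => m ma.
  by rewrite /bump; case: leqP => /=; lia.
rewrite face_simp_map; apply: tail_sum_simp_map => m ma; have := ltn_ord j.
by rewrite /bump; case: leqP; case: leqP => /=; lia.
Qed.

(** Here the face is taken in the base of the prism, so [bump j] acts after [th] and the time split
    stays at [t]. *)
Lemma prism_cell_of_face (R : realType) (X Y : topologicalType) (H : X * R -> Y)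
    (cH : continuous H) a b th t (s : singular R b.+1 X) (j : 'I_b.+2) :
  (forall m, (m <= a)%N -> (th m <= b)%N) ->
  prism_cell cH a th t ((s : continuousType _ _) \o face j) =
  prism_cell cH a (bump j \o th) t s.
Proof.
move=> thb; apply/continuousEP => x /=; rewrite /mkcts.
by rewrite face_simp_map simp_map_comp.
Qed.

Lemma prism_cell_eq (R : realType) (X Y : topologicalType) (H : X * R -> Y)
    (cH : continuous H) a b th th' t (s : singular R b X) :
  (forall m, (m <= a)%N -> th m = th' m) ->
  prism_cell cH a th t s = prism_cell cH a th' t s.
Proof.
move=> E; apply/continuousEP => x /=; rewrite /mkcts.
congr (H ((s : continuousType _ _) _, _)).
apply: val_inj; apply/rowP => j; rewrite !mxE; apply: eq_bigl => m.
by rewrite E// -ltnS.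
Qed.

(** * Additive maps on formal sums *)

Section ChainMaps.
Context (K : choiceType) (M : lmodType int).

(** Boundaries, pushforwards and the prism operator are all given by [fglift], so each of them
    inherits the lemmas on additive maps. *)
HB.instance Definition _ (f : K -> M) :=
  GRing.isAdditive.Build {freeg K / int} M (fglift f) (lift_is_additive f).

Lemma freeg_additive_ext (u v : {additive {freeg K / int} -> M}) :
  (forall z, u << 1 *g z >> = v << 1 *g z >>) -> u =1 v.
Proof.
move=> uv c; rewrite -(freeg_sumE c) !raddf_sum; apply: eq_bigr => z _.
have -> : << (coeff z c) *g z >> = << 1 *g z >> *~ coeff z c.
  by rewrite freegU_mulz intz.
by rewrite !raddfMz uv.
Qed.

End ChainMaps.

Section Homotopy.
Context (R : realType) (X Y : topologicalType) (H : X * R -> Y).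
Hypothesis cH : continuous H.

Lemma scale_freegU (K : choiceType) (c d : int) (x : K) :
  c *: << d *g x >> = c * d *: << 1 *g x >> :> {freeg K / int}.
Proof.
by apply/eqP/freeg_eqP => z; rewrite !coeffZ !coeffU mulrA mul1r.
Qed.

(** The prism formula on one simplex: the faces shared by consecutive cells cancel, which leaves the
    copies at times 1 and 0 and the prism over the boundary. *)
Lemma boundary_prism k (s : singular R k.+1 X) :
  boundary (prism cH s) =
  << 1 *g prism_cell cH k.+1 id 0 s >> - << 1 *g prism_cell cH k.+1 id k.+2 s >>
  - fglift (prism cH (k := k)) (boundary << 1 *g s >>).
Proof.
rewrite /boundary liftU scale1r [fglift (prism cH (k := k)) _]raddf_sum /=.
under [in RHS]eq_bigr => i _ do rewrite liftU /prism scaler_sumr.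
rewrite [in LHS]/prism [LHS]raddf_sum /=.
under [LHS]eq_bigr => i _ do rewrite liftU scaler_sumr.
pose c th t : chain R k.+1 Y := << 1 *g prism_cell cH k.+1 th t s >>.
(* [A i j] is the signed [j]-th face of the [i]-th cell, and [B i j] the signed [i]-th cell over the
   [j]-th face of [s]. The cells [c id i] are the shared faces. *)
pose A i j := (-1) ^+ i * (-1) ^+ j *: c (unbump i \o bump j) (i.+1 - (j < i.+1))%N.
pose B i j := (-1) ^+ j * (-1) ^+ i *: c (bump j \o unbump i) i.+1.
transitivity (\sum_(i < k.+2) \sum_(j < k.+3) A i j).
  apply: eq_bigr => i _; apply: eq_bigr => j _.
  rewrite scale_freegU prism_cell_face// => m mk; have := ltn_ord i.
  by rewrite /unbump; case: ltnP => /=; lia.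
rewrite (@sum_prism_faces _ _ A B (c id)) /A /B /c.
- congr (_ - _); rewrite exchange_big/=.
  apply: eq_bigr => j _; apply: eq_bigr => i _.
  rewrite [RHS]scale_freegU prism_cell_of_face// => m mk; have := ltn_ord i.
  by rewrite /unbump; case: ltnP => /=; lia.
(* Deleting a vertex [v_j] with [j < i] gives cell [i.-1] over a face of [s]; deleting [w_(j-1)]
   with [j > i.+1] gives cell [i]. Deleting [v_i] or [w_i] leaves a shared face. *)
- move=> i j ji iK; rewrite -scaleNr; congr (_ *: _).
    by rewrite -[in LHS](prednK (leq_ltn_trans (leq0n j) ji)) exprS; ring.
  have -> : (i.+1 - (j < i.+1) = i.-1.+1)%N by lia.
  congr (<< 1 *g _ >>); apply: prism_cell_eq => m mk.
  by rewrite /= /bump /unbump; lia.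
- move=> i j ij jK; rewrite -scaleNr; congr (_ *: _).
    by rewrite -[in LHS](prednK (leq_ltn_trans (leq0n _) ij)) exprS; ring.
  have -> : (i.+1 - (j < i.+1) = i.+1)%N by lia.
  congr (<< 1 *g _ >>); apply: prism_cell_eq => m mk.
  by rewrite /= /bump /unbump; lia.
- move=> i iK; rewrite -expr2 sqrr_sign scale1r ltnSn subn1.
  congr (<< 1 *g _ >>); apply: prism_cell_eq => m mk.
  by rewrite /= /bump /unbump; lia.
- move=> i iK; rewrite exprS mulrCA -expr2 sqrr_sign mulr1 scaleN1r ltnn subn0.
  congr (- << 1 *g _ >>); apply: prism_cell_eq => m mk.
  by rewrite /= /bump /unbump; lia.
Qed.

Context (f g : continuousType X Y).
Hypotheses (H0 : forall x, H (x, 0) = f x) (H1 : forall x, H (x, 1) = g x).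

(** Both sides are additive, so generators suffice. The split 0 puts the whole simplex at time 1,
    and the split [k.+2] lies beyond its last vertex and puts it at time 0. *)
Lemma boundary_prism_chain k (c : chain R k.+1 X) :
  boundary (fglift (prism cH (k := k.+1)) c) =
  Defs.pushforward g c - Defs.pushforward f c
  - fglift (prism cH (k := k)) (boundary c).
Proof.
apply: (@freeg_additive_ext _ _
  (fglift _ \o fglift (prism cH (k := k.+1)))
  ((fglift _ \- fglift _) \- (fglift (prism cH (k := k)) \o fglift _))) => s /=.
rewrite liftU scale1r [LHS]boundary_prism; congr (_ - _ - _);
  rewrite liftU scale1r; congr (<< 1 *g _ >>); apply/continuousEP => x /=;
  rewrite /mkcts simp_map_id//.
- by rewrite tail_sum0 H1.
- by rewrite tail_sum_oob// H0.
Qed.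

Lemma homotopic_pushforward k (c : chain R k.+1 X) : boundary c = 0 ->
  exists b : chain R k.+2 Y,
    Defs.pushforward g c - Defs.pushforward f c = boundary b.
Proof.
move=> c0; exists (fglift (prism cH (k := k.+1)) c).
by rewrite boundary_prism_chain c0 [fglift _ 0]raddf0 subr0.
Qed.

End Homotopy.

Lemma pushforward_id (R : realType) (X : topologicalType) k (c : chain R k X) :
  Defs.pushforward (idfun : continuousType X X) c = c.
Proof.
apply: (@freeg_additive_ext _ _ (fglift _) idfun) => s /=.
by rewrite liftU scale1r; congr (<< 1 *g _ >>); apply/continuousEP.
Qed.

(** Homotopic maps differ by a boundary on every cycle, and the identity fixes every chain. *)
Lemma homotopic_id_orientation_preserving (R : realType)
    (f : continuousType (S3 R) (S3 R)) (H : S3 R * R -> S3 R) :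
  continuous H -> (forall x, H (x, 0) = x) -> (forall x, H (x, 1) = f x) ->
  orientation_preserving f.
Proof.
move=> cH H0 H1 c c0.
have [b bE] := homotopic_pushforward cH (f := idfun) H0 H1 c0.
by exists b; rewrite -bE pushforward_id.
Qed.

(** * Radial homeomorphisms of the 3-sphere *)

Section PolarCoordinates.
Variable R : realType.
Implicit Types (p : S3 R) (x u : 'rV[R]_3) (w r s : R).

Lemma sqnormZ k c (x : 'rV[R]_k) : sqnorm (c *: x) = c ^+ 2 * sqnorm x.
Proof.
by rewrite /sqnorm mulr_sumr; apply: eq_bigr => j _; rewrite mxE exprMn.
Qed.

Lemma sqnormN k (x : 'rV[R]_k) : sqnorm (- x) = sqnorm x.
Proof. by rewrite -scaleN1r sqnormZ sqrrN expr1n mul1r. Qed.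

Lemma sqnorm_ge0 k (x : 'rV[R]_k) : 0 <= sqnorm x.
Proof. by apply: sumr_ge0 => j _; exact: sqr_ge0. Qed.

Lemma sqnorm_eq0 k (x : 'rV[R]_k) : (sqnorm x == 0) = (x == 0).
Proof.
apply/idP/eqP => [|->].
  rewrite psumr_eq0 => [/allP x0|j _]; last exact: sqr_ge0.
  apply/rowP => j; rewrite mxE; apply/eqP.
  by have := x0 j; rewrite mem_index_enum sqrf_eq0 => /(_ isT).
by rewrite /sqnorm big1// => j _; rewrite mxE expr0n.
Qed.

Lemma coord_le_sqnorm k (x : 'rV[R]_k) j : sqnorm x = 1 -> `|x 0 j| <= 1.
Proof.
move=> x1; rewrite -(@expr_le1 _ 2)// real_normK ?num_real// -x1.
rewrite /sqnorm (bigD1 j)//= lerDl.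
by apply: sumr_ge0 => i _; exact: sqr_ge0.
Qed.

Lemma sqnorm_continuous k : continuous (@sqnorm R k).
Proof.
apply: continuous_big => [|j _ x]; first exact: add_continuous.
under eq_fun do rewrite expr2.
by apply: (@cvgM _ _ (nbhs x)); exact: coord_continuous.
Qed.

Definition equatorial p : 'rV[R]_3 := lsubmx (val p).
Definition altitude p : R := val p 0 (rshift 3 0).
(** The value at the two poles is 0; [radial_map] treats the poles separately. *)
Definition direction p : 'rV[R]_3 :=
  (Num.sqrt (sqnorm (equatorial p)))^-1 *: equatorial p.
(* The inverse of s |-> (exp(2 s) - 1) / (exp(2 s) + 1), the altitude of
   stereo (exp(s) u) for a unit vector u. *)
Definition log_radius w : R := (ln (1 + w) - ln (1 - w)) / 2.

Lemma sqnorm_equatorial p : sqnorm (equatorial p) = 1 - altitude p ^+ 2.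
Proof.
have /set_mem := valP p; rewrite /sphere /= /sqnorm big_split_ord /= big_ord1.
move=> <-; rewrite /altitude addrK.
by apply: eq_bigr => j _; rewrite mxE.
Qed.

Lemma altitude_itv p : equatorial p != 0 -> -1 < altitude p < 1.
Proof.
move=> y0; have : 0 < sqnorm (equatorial p) by rewrite lt0r sqnorm_eq0 y0 sqnorm_ge0.
rewrite sqnorm_equatorial subr_gt0 => w2.
by rewrite -ltr_norml -(@expr_lt1 _ 2)// real_normK ?num_real.
Qed.

Lemma sqnorm_direction p : equatorial p != 0 -> sqnorm (direction p) = 1.
Proof.
move=> y0; rewrite sqnormZ exprVn sqr_sqrtr ?sqnorm_ge0// mulVf//.
by rewrite sqnorm_eq0.
Qed.

Lemma stereo_polarE r u : sqnorm u = 1 -> val (stereo (r *: u)) =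
  row_mx ((2 * r / (r ^+ 2 + 1)) *: u) (((r ^+ 2 - 1) / (r ^+ 2 + 1))%:M).
Proof.
move=> u1; rewrite /= /stereo_row sqnormZ u1 mulr1 scalerA.
by congr row_mx; congr (_ *: _); rewrite mulrAC.
Qed.

Lemma equatorial_stereo r u : sqnorm u = 1 ->
  equatorial (stereo (r *: u)) = (2 * r / (r ^+ 2 + 1)) *: u.
Proof. by move=> u1; rewrite /equatorial stereo_polarE// row_mxKl. Qed.

Lemma altitude_stereo r u : sqnorm u = 1 ->
  altitude (stereo (r *: u)) = (r ^+ 2 - 1) / (r ^+ 2 + 1).
Proof. by move=> u1; rewrite /altitude stereo_polarE// row_mxEr mxE eqxx. Qed.

Lemma sqrD1_gt0 r : 0 < r ^+ 2 + 1.
Proof. by rewrite ltr_pwDr// sqr_ge0. Qed.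

Lemma equatorial_polar_neq0 s u : sqnorm u = 1 ->
  equatorial (stereo (expR s *: u)) != 0.
Proof.
move=> u1; rewrite equatorial_stereo// scaler_eq0 negb_or; apply/andP; split.
  by rewrite lt0r_neq0// divr_gt0 ?sqrD1_gt0// mulr_gt0// expR_gt0.
by rewrite -sqnorm_eq0 u1 oner_eq0.
Qed.

Lemma direction_polar s u : sqnorm u = 1 -> direction (stereo (expR s *: u)) = u.
Proof.
move=> u1; rewrite /direction equatorial_stereo// sqnormZ u1 mulr1 sqrtr_sqr.
have e0 := expR_gt0 s; set c := _ / _; have c0 : 0 < c.
  by rewrite divr_gt0 ?sqrD1_gt0// mulr_gt0.
by rewrite gtr0_norm// scalerA mulVf ?scale1r// gt_eqF.
Qed.

Lemma log_radius_polar s u : sqnorm u = 1 ->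
  log_radius (altitude (stereo (expR s *: u))) = s.
Proof.
move=> u1; rewrite altitude_stereo// /log_radius; set r := expR s.
have r0 : 0 < r := expR_gt0 s; have d0 := sqrD1_gt0 r.
have dn : r ^+ 2 + 1 != 0 by rewrite gt_eqF.
(* For the altitude [w] this gives [1 + w = r ^+ 2 * (1 - w)], so the difference of logarithms is
   twice [s]. *)
have -> : 1 + (r ^+ 2 - 1) / (r ^+ 2 + 1) = r ^+ 2 * (2 / (r ^+ 2 + 1)) by field.
have -> : 1 - (r ^+ 2 - 1) / (r ^+ 2 + 1) = 2 / (r ^+ 2 + 1) by field.
rewrite lnM ?posrE ?exprn_gt0 ?divr_gt0// addrK lnXn// expRK.
by rewrite mulr2n; field.
Qed.

Lemma polarK p : equatorial p != 0 ->
  stereo (expR (log_radius (altitude p)) *: direction p) = p.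
Proof.
move=> y0; have u1 := sqnorm_direction y0.
apply: val_inj; rewrite stereo_polarE// -[RHS]hsubmxK.
set r := expR _; set w := altitude p.
have /andP[w1 w2] := altitude_itv y0; rewrite -/w in w1 w2.
have r2 : r ^+ 2 = (1 + w) / (1 - w).
  rewrite /r -expRM_natl /log_radius -/w.
  have -> : 2 * ((ln (1 + w) - ln (1 - w)) / 2) = ln (1 + w) - ln (1 - w) by field.
  by rewrite expRD expRN !lnK// posrE; lra.
have yE : sqnorm (equatorial p) = 1 - w ^+ 2 := sqnorm_equatorial p.
have wn : 1 - w != 0 by rewrite gt_eqF; lra.
congr row_mx; last first.
  apply/rowP => j; rewrite !mxE (ord1 j) eqxx mulr1n r2.
  transitivity w; last by rewrite /w /altitude.
  by field; rewrite wn/= gt_eqF//; lra.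
rewrite /direction scalerA yE.
(* The factor [2 * r / (r ^+ 2 + 1)] is the norm of the equatorial part. It equals [r * (1 - w)],
   whose square is [1 - w ^+ 2]. *)
suff -> : 2 * r / (r ^+ 2 + 1) / Num.sqrt (1 - w ^+ 2) = 1 by rewrite scale1r.
have s0 : 0 < Num.sqrt (1 - w ^+ 2) by rewrite sqrtr_gt0; nra.
have -> : 2 * r / (r ^+ 2 + 1) = r * (1 - w).
  by rewrite r2; field; rewrite wn/= gt_eqF//; lra.
apply/eqP; rewrite -(@eqrXn2 _ 2)//; last first.
- by rewrite divr_ge0 ?mulr_ge0 ?expR_ge0 ?ltW//; lra.
rewrite !exprMn exprVn sqr_sqrtr ?r2 ?expr1n; last by nra.
by apply/eqP; field; rewrite wn/= gt_eqF//; nra.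
Qed.

End PolarCoordinates.

(** * The antipode in polar coordinates *)

Section Antipode.
Variable R : realType.
Implicit Types (p : S3 R) (u : 'rV[R]_3) (s : R).

Lemma equatorialN p : equatorial (antipode p) = - equatorial p.
Proof. by apply/rowP => j; rewrite !mxE. Qed.

Lemma altitudeN p : altitude (antipode p) = - altitude p.
Proof. by rewrite /altitude mxE. Qed.

Lemma directionN p : direction (antipode p) = - direction p.
Proof. by rewrite /direction equatorialN sqnormN scalerN. Qed.

Lemma log_radiusN (w : R) : log_radius (- w) = - log_radius w.
Proof. by rewrite /log_radius opprK -mulNr opprB. Qed.

Lemma antipodeK : involutive (@antipode R).
Proof. by move=> p; apply: val_inj; rewrite /= opprK. Qed.

(** In R^3 the antipode is [x |-> - x / |x|^2], which negates direction and log-height. Both sides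
    are compared through their polar coordinates. *)
Lemma antipode_polar s u : sqnorm u = 1 ->
  antipode (stereo (expR s *: u)) = stereo (expR (- s) *: - u).
Proof.
move=> u1; rewrite -[RHS]antipodeK; congr antipode.
rewrite -[LHS]polarK ?equatorial_polar_neq0// direction_polar// log_radius_polar//.
have Nu1 : sqnorm (- u) = 1 by rewrite sqnormN.
have y0 : equatorial (antipode (stereo (expR (- s) *: - u))) != 0.
  by rewrite equatorialN oppr_eq0 equatorial_polar_neq0.
rewrite -[RHS]polarK// directionN altitudeN direction_polar//.
by rewrite log_radiusN log_radius_polar// !opprK.
Qed.

End Antipode.

(** * Affine changes of log-height along rays *)

Section RadialMap.
Variable R : realType.
Implicit Types (a b : 'rV[R]_3 -> R) (p : S3 R) (t : R).

(** The slope is written as an exponential so that it is positive at every time and equals 1 at time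
    0. The poles are fixed. *)
Definition radial_map a b (q : S3 R * R) : S3 R :=
  let u := direction q.1 in
  if equatorial q.1 == 0 then q.1 else
  stereo (expR (expR (q.2 * a u) * log_radius (altitude q.1) + q.2 * b u) *: u).

Lemma radial_map0 a b p : radial_map a b (p, 0) = p.
Proof.
rewrite /radial_map /=; case: ifPn => // y0.
by rewrite !mul0r expR0 mul1r addr0 polarK.
Qed.

Lemma radial_map_polar a b s u t : sqnorm u = 1 ->
  radial_map a b (stereo (expR s *: u), t) =
  stereo (expR (expR (t * a u) * s + t * b u) *: u).
Proof.
move=> u1; rewrite /radial_map /= (negbTE (equatorial_polar_neq0 _ u1)).
by rewrite direction_polar// log_radius_polar.
Qed.

(** The hypotheses say that on each ray [s |-> expR a' * s + b'] is a left inverse of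
    [s |-> expR a * s + b]. *)
Lemma radial_map_cancel a b a' b' :
  (forall u, a u + a' u = 0) -> (forall u, expR (a' u) * b u + b' u = 0) ->
  cancel (fun p => radial_map a b (p, 1)) (fun p => radial_map a' b' (p, 1)).
Proof.
move=> aa' bb' p; rewrite {2}/radial_map /=; case: ifPn => y0.
  by rewrite /radial_map /= y0.
have u1 := sqnorm_direction y0.
rewrite radial_map_polar// !mul1r mulrDr mulrA -expRD [a' _ + a _]addrC aa'.
by rewrite expR0 mul1r -addrA bb' addr0 polarK.
Qed.

(** Conjugation by the antipode yields another radial map. This reduces continuity at the south pole
    to continuity at the north pole. *)
Lemma radial_mapN a b p t :
  radial_map a b (antipode p, t) =
  antipode (radial_map (fun u => a (- u)) (fun u => - b (- u)) (p, t)).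
Proof.
rewrite /radial_map /= equatorialN oppr_eq0; case: ifPn => // y0.
rewrite antipode_polar ?sqnorm_direction// directionN altitudeN log_radiusN.
by rewrite opprD !mulrN opprK.
Qed.

Lemma altitude_continuous : continuous (@altitude R).
Proof.
move=> p; apply: (@continuous_comp _ _ _ (fun y : S3 R => val y)
  (fun M : 'rV[R]_(3 + 1) => M 0 (rshift 3 0))).
  exact: initial_continuous.
exact: coord_continuous.
Qed.

Lemma equatorial_continuous : continuous (@equatorial R).
Proof.
apply: continuous_rV => j.
have -> : (fun p : S3 R => equatorial p 0 j) = (fun p => val p 0 (lshift 1 j)).
  by apply/funext => p; rewrite mxE.
move=> p; apply: (@continuous_comp _ _ _ (fun y : S3 R => val y)
  (fun M : 'rV[R]_(3 + 1) => M 0 (lshift 1 j))).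
  exact: initial_continuous.
exact: coord_continuous.
Qed.

Lemma stereo_row_continuous : continuous (@stereo_row R).
Proof.
have inv (x : 'rV[R]_3) : (sqnorm y + 1)^-1 @[y --> x] --> (sqnorm x + 1)^-1.
  apply: (@cvgV _ _ (nbhs x)); first by rewrite lt0r_neq0// ltr_pwDr// sqnorm_ge0.
  by apply: (@cvgD _ _ _ (nbhs x)); [exact: sqnorm_continuous|exact: cvg_cst].
apply: continuous_rV => j; case: (split_ordP j) => i ->.
  have -> : (fun x : 'rV[R]_3 => stereo_row x 0 (lshift 1 i)) =
      (fun x => 2 * (sqnorm x + 1)^-1 * x 0 i).
    by apply/funext => x; rewrite row_mxEl mxE.
  move=> x; apply: (@cvgM _ _ (nbhs x)); last exact: coord_continuous.
  by apply: (@cvgM _ _ (nbhs x)); [exact: cvg_cst|exact: inv].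
have -> : (fun x : 'rV[R]_3 => stereo_row x 0 (rshift 3 i)) =
    (fun x => (sqnorm x - 1) * (sqnorm x + 1)^-1).
  by apply/funext => x; rewrite row_mxEr mxE (ord1 i) eqxx.
move=> x; apply: (@cvgM _ _ (nbhs x)); last exact: inv.
by apply: (@cvgB _ _ _ (nbhs x)); [exact: sqnorm_continuous|exact: cvg_cst].
Qed.

End RadialMap.

(** * Continuity of radial maps, including the poles *)

Section RadialMapContinuity.
Variable R : realType.
Implicit Types (a b : 'rV[R]_3 -> R) (p : S3 R) (t : R) (q : S3 R * R).

Lemma antipode_continuous : continuous (@antipode R).
Proof.
apply: continuous_comp_initial; apply: continuous_rV => j.
have -> : (fun p : S3 R => (val \o @antipode R) p 0 j) = (fun p => - val p 0 j).
  by apply/funext => p; rewrite mxE.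
move=> p; apply: (@cvgN _ _ _ (nbhs p)).
apply: (@continuous_comp _ _ _ (fun y : S3 R => val y)
  (fun M : 'rV[R]_(3 + 1) => M 0 j)); first exact: initial_continuous.
exact: coord_continuous.
Qed.

Lemma direction_continuous p : equatorial p != 0 ->
  {for p, continuous (@direction R)}.
Proof.
move=> y0; apply: (@cvgZ _ _ _ (nbhs p)); last exact: equatorial_continuous.
apply: (@cvgV _ _ (nbhs p)).
  by rewrite lt0r_neq0// sqrtr_gt0 lt0r sqnorm_eq0 y0 sqnorm_ge0.
apply: (@continuous_comp _ _ _ (fun p : S3 R => sqnorm (equatorial p)) Num.sqrt).
  by apply: continuous_comp; [exact: equatorial_continuous|exact: sqnorm_continuous].
exact: sqrt_continuous.
Qed.

Lemma log_radius_continuous (w : R) : -1 < w < 1 -> {for w, continuous (@log_radius R)}.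
Proof.
move=> /andP[w1 w2]; apply: (@cvgM _ _ (nbhs w)); last exact: cvg_cst.
apply: (@cvgB _ _ _ (nbhs w)).
  apply: (@continuous_cvg _ _ _ (nbhs w)); first by apply: continuous_ln; lra.
  by apply: (@cvgD _ _ _ (nbhs w)); [exact: cvg_cst|exact: cvg_id].
apply: (@continuous_cvg _ _ _ (nbhs w)); first by apply: continuous_ln; lra.
by apply: (@cvgB _ _ _ (nbhs w)); [exact: cvg_cst|exact: cvg_id].
Qed.

Lemma radial_formula_continuous a b q : continuous a -> continuous b ->
  equatorial q.1 != 0 ->
  {for q, continuous (fun q => expR (expR (q.2 * a (direction q.1))
     * log_radius (altitude q.1) + q.2 * b (direction q.1)) *: direction q.1)}.
Proof.
move=> ca cb y0.
have c1 : {for q, continuous (fun q : S3 R * R => q.1)} by exact: cvg_fst.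
have c2 : {for q, continuous (fun q : S3 R * R => q.2)} by exact: cvg_snd.
have cu : {for q, continuous (fun q => direction q.1)}.
  by apply: (continuous_comp c1); exact: direction_continuous.
have cf (f : 'rV[R]_3 -> R) : continuous f ->
    {for q, continuous (fun q => q.2 * f (direction q.1))}.
  move=> cf; apply: (@cvgM _ _ (nbhs q)); first exact: c2.
  by apply: (continuous_comp cu); exact: cf.
apply: (@cvgZ _ _ _ (nbhs q)); last exact: cu.
apply: (@continuous_cvg _ _ _ (nbhs q)); first exact: continuous_expR.
apply: (@cvgD _ _ _ (nbhs q)); last exact: cf.
apply: (@cvgM _ _ (nbhs q)).
  by apply: (@continuous_cvg _ _ _ (nbhs q)); [exact: continuous_expR|exact: cf].
apply: (@continuous_comp _ _ _ (fun q : S3 R * R => altitude q.1) (@log_radius R)).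
  by apply: (continuous_comp c1); exact: altitude_continuous.
by apply: log_radius_continuous; exact: altitude_itv.
Qed.

Lemma radial_map_continuous_off_poles a b q j : continuous a -> continuous b ->
  equatorial q.1 != 0 ->
  {for q, continuous (fun q => val (radial_map a b q) 0 j)}.
Proof.
move=> ca cb y0; pose g q := expR (expR (q.2 * a (direction q.1))
     * log_radius (altitude q.1) + q.2 * b (direction q.1)) *: direction q.1.
have E q' : equatorial q'.1 != 0 ->
    val (radial_map a b q') 0 j = stereo_row (g q') 0 j.
  by move=> y'0; rewrite /radial_map (negbTE y'0).
have : stereo_row (g q') 0 j @[q' --> q] --> val (radial_map a b q) 0 j.
  rewrite E//; apply: (@continuous_comp _ _ _ (fun q => stereo_row (g q))
    (fun M : 'rV[R]_(3 + 1) => M 0 j)); last exact: coord_continuous.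
  apply: (@continuous_comp _ _ _ g (@stereo_row R)).
    exact: radial_formula_continuous.
  exact: stereo_row_continuous.
(* Being off the poles is an open condition, so the map agrees with the formula near [q]. *)
apply: cvg_trans; apply: near_eq_cvg.
have cy : sqnorm (equatorial q'.1) @[q' --> q] --> sqnorm (equatorial q.1).
  apply: (@continuous_comp _ _ _ (fun q : S3 R * R => q.1)
    (fun p => sqnorm (equatorial p))); first exact: cvg_fst.
  by apply: continuous_comp; [exact: equatorial_continuous|exact: sqnorm_continuous].
have : sqnorm (equatorial q.1) != 0 by rewrite sqnorm_eq0.
move=> /(cvgr_neq0 _ cy); apply: filterS => q'.
by rewrite sqnorm_eq0 => /E ->.
Qed.

(* Near the north pole the new log-height al s + be is uniformly large. *)
Lemma radial_small (T eps : R) : 0 < eps -> exists2 eta : R, 0 < eta &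
  forall w al be : R, 0 <= w < 1 -> 1 - w < eta ->
    expR (- T) <= al -> - T <= be ->
    expR (- (al * log_radius w + be)) <= eps.
Proof.
(* This [eta] forces [log_radius w] to be at least [expR T * (T - ln eps)]; after scaling by at
   least [expR (- T)] and a shift by at least [- T], at least [- ln eps] remains. *)
move=> eps0; exists (expR (- (2 * expR T * (T - ln eps)))); first exact: expR_gt0.
move=> w al be /andP[w0 w1] w_eta al_ge be_ge.
rewrite -[leRHS]lnK ?posrE// ler_expR.
have s_ge : - ln (1 - w) / 2 <= log_radius w.
  have : 0 <= ln (1 + w) by apply: ln_ge0; lra.
  by rewrite /log_radius; lra.
have l_eta : 2 * expR T * (T - ln eps) <= - ln (1 - w).
  rewrite lerNr -[leRHS]expRK ler_ln ?posrE ?expR_gt0 ?ltW//.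
  by lra.
have s0 : 0 <= log_radius w.
  have : ln (1 - w) <= 0 by apply: ln_le0; lra.
  by move=> ?; apply: le_trans s_ge; lra.
have : expR (- T) * log_radius w <= al * log_radius w by rewrite ler_wpM2r.
have : T - ln eps <= expR (- T) * log_radius w.
  rewrite -(@ler_pM2l _ (expR T)) ?expR_gt0// mulrA -expRD subrr expR0 mul1r.
  by apply: le_trans s_ge; lra.
by lra.
Qed.

Lemma val_S3E p : val p = row_mx (equatorial p) (altitude p)%:M.
Proof.
rewrite -[LHS]hsubmxK; congr row_mx; apply/rowP => j.
by rewrite !mxE (ord1 j) eqxx mulr1n.
Qed.

(** The equatorial coordinates are at most [2 * r / (r ^+ 2 + 1)] in absolute value, and the
    altitude is [2 / (r ^+ 2 + 1)] below 1. Both are at most [2 / r]. *)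
Lemma polar_near_pole (u : 'rV[R]_3) (r : R) (j : 'I_(3 + 1)) :
  sqnorm u = 1 -> 0 < r ->
  `|row_mx 0 (1%:M : 'M[R]_1) 0 j - val (stereo (r *: u)) 0 j| <= 2 * r^-1.
Proof.
move=> u1 r0; rewrite stereo_polarE//; have d0 := sqrD1_gt0 r.
case: (split_ordP j) => i ->.
  rewrite !row_mxEl !mxE sub0r normrN normrM.
  have c0 : 0 <= 2 * r / (r ^+ 2 + 1) by rewrite divr_ge0 ?mulr_ge0 ?ltW.
  rewrite (ger0_norm c0) (le_trans (ler_piMr c0 (coord_le_sqnorm i u1)))//.
  rewrite ler_pdivrMr// -mulrA ler_pM2l// expr2 mulrDr mulrA mulVf ?gt_eqF//.
  by rewrite mul1r mulr1 lerDl invr_ge0 ltW.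
rewrite !row_mxEr !mxE (ord1 i) eqxx !mulr1n.
have -> : 1 - (r ^+ 2 - 1) / (r ^+ 2 + 1) = 2 / (r ^+ 2 + 1).
  by field; rewrite gt_eqF.
rewrite ger0_norm; last by rewrite divr_ge0// ltW.
rewrite ler_pM2l// lef_pV2 ?posrE//.
by nra.
Qed.

(** The direction has no limit at the pole, so the argument rests on the bounds for [a] and [b]:
    they make the new log-height tend to infinity uniformly in the direction. *)
Lemma radial_map_continuous_north a b C q j :
  (forall u, `|a u| <= C) -> (forall u, `|b u| <= C) -> altitude q.1 = 1 ->
  {for q, continuous (fun q => val (radial_map a b q) 0 j)}.
Proof.
move=> aC bC w1.
have y_eq0 p : altitude p = 1 -> equatorial p = 0.
  by move=> E; apply/eqP; rewrite -sqnorm_eq0 sqnorm_equatorial E expr1n subrr.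
apply/cvgrPdist_le => eps eps0.
(* [T] bounds [t * a u] and [t * b u] for all times [t] within 1 of [q.2]. *)
pose T := C * (`|q.2| + 1).
have [eta eta0 small] := @radial_small T (eps / 2) (divr_gt0 eps0 (ltr0n R 2)).
have cw : altitude q'.1 @[q' --> q] --> (1 : R).
  rewrite -w1; apply: (@continuous_comp _ _ _ (fun q : S3 R * R => q.1)
    (@altitude R)); first exact: cvg_fst.
  exact: altitude_continuous.
have ct : q'.2 @[q' --> q] --> q.2 by exact: cvg_snd.
have near_w0 : \forall q' \near q, 0 < altitude q'.1.
  by apply: (cvgr_gt 1 cw); lra.
have near_w1 : \forall q' \near q, 1 - eta < altitude q'.1.
  by apply: (cvgr_gt 1 cw); lra.
have near_t : \forall q' \near q, `|q.2 - q'.2| < 1.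
  by move/cvgrPdist_lt : ct; apply.
near=> q'.
have w'0 : 0 < altitude q'.1 by near: q'.
have w'1 : 1 - eta < altitude q'.1 by near: q'.
have t' : `|q.2 - q'.2| < 1 by near: q'.
have -> : val (radial_map a b q) = row_mx 0 1%:M.
  by rewrite /radial_map y_eq0// eqxx val_S3E w1 y_eq0.
(* The nearby point may itself be a pole; its positive altitude then makes it the north pole. *)
rewrite /radial_map; case: ifPn => [/eqP y'0|y'0].
  have w'E : altitude q'.1 = 1.
    have := sqnorm_equatorial q'.1; rewrite y'0 /sqnorm big1 => [E|i _].
      by nra.
    by rewrite mxE expr0n.
  by rewrite val_S3E w'E y'0 subrr normr0 ltW.
have bound (f : 'rV[R]_3 -> R) u : (forall u, `|f u| <= C) -> `|q'.2 * f u| <= T.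
  move=> fC; rewrite normrM mulrC ler_pM//.
  by rewrite -[q'.2](subKr q.2) (le_trans (ler_normB _ _))// lerD2l ltW.
have /andP[_ w'lt1] := altitude_itv y'0.
rewrite (le_trans (polar_near_pole _ (sqnorm_direction y'0) (expR_gt0 _)))//.
rewrite -expRN mulrC -ler_pdivlMr//; apply: small.
- by rewrite ltW.
- by lra.
- rewrite ler_expR lerNl; apply: (le_trans _ (bound a (direction q'.1) aC)).
  by rewrite -normrN ler_norm.
- rewrite lerNl; apply: (le_trans _ (bound b (direction q'.1) bC)).
  by rewrite -normrN ler_norm.
Unshelve. all: by end_near. Qed.

Lemma radial_map_continuous a b C : continuous a -> continuous b ->
  (forall u, `|a u| <= C) -> (forall u, `|b u| <= C) ->
  continuous (radial_map a b).
Proof.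
move=> ca cb aC bC; apply: continuous_comp_initial; apply: continuous_rV => j q.
have [y0|] := eqVneq (equatorial q.1) 0; last first.
  exact: radial_map_continuous_off_poles.
have : altitude q.1 ^+ 2 == 1.
  have := sqnorm_equatorial q.1; rewrite y0 /sqnorm big1 => [E|i _].
    by apply/eqP; lra.
  by rewrite mxE expr0n.
rewrite sqrf_eq1 => /orP[] /eqP w1.
  exact: (radial_map_continuous_north (C := C)).
(* At the south pole the map is rewritten as an antipodal conjugate and evaluated near the north
   pole. *)
have -> : (fun q => (val \o radial_map a b) q 0 j) =
    (fun q => - val (radial_map (fun u => a (- u)) (fun u => - b (- u)) q) 0 j) \o
    (fun q : S3 R * R => (antipode q.1, q.2)).
  apply/funext => -[p t] /=.
  have := radial_mapN a b (antipode p) t; rewrite antipodeK => ->.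
  by rewrite mxE.
have cN : antipode q'.1 @[q' --> q] --> antipode q.1.
  apply: (@continuous_comp _ _ _ (fun q : S3 R * R => q.1) (@antipode R)).
    exact: cvg_fst.
  exact: antipode_continuous.
apply: continuous_comp; first exact: (cvg_pair cN cvg_snd).
apply: (@cvgN _ _ _ (nbhs _)).
apply: (@radial_map_continuous_north _ _ C) => //=.
- by move=> u; rewrite normrN.
- by rewrite altitudeN w1 opprK.
Qed.

End RadialMapContinuity.

(** * The medial map of the wheel *)

Section WheelDrawing.
Variable R : realType.
Implicit Types x y a z t : R.

Lemma cos_eq1 x : cos x = 1 -> exists m : int, x = 2 * pi * m%:~R.
Proof.
(* The floor puts [y], the remainder of [x], in [[0, 2 pi[]. On [[0, pi]] cosine is injective;
   beyond [pi] the reflection [2 pi - y] would be 0, which is excluded. *)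
move=> cx; pose m := Num.floor (x / (2 * pi)); exists m.
have pi0 : 0 < pi :> R := pi_gt0 R.
have := floor_itv (x / (2 * pi)); rewrite -/m => /andP[].
rewrite ler_pdivlMr ?ltr_pdivrMr ?mulr_gt0// intrD1 => mx xm.
pose y := x - 2 * pi * m%:~R.
have cy : cos y = 1.
  have per (k : nat) a : cos (a + 2 * pi * k%:R) = cos a :> R.
    rewrite -[RHS](periodicn (@cosD2pi R) k a); congr cos.
    by rewrite -[in RHS]mulr_natr mulr2n; ring.
  rewrite /y; case: (m) => k.
    by rewrite -(per k) -[RHS]cx; congr cos; rewrite -pmulrn; ring.
  by rewrite NegzE mulrNz mulrN opprK -pmulrn per.
suff : y = 0 by rewrite /y; lra.
have y0 : 0 <= y by rewrite /y; lra.
have [ypi|piy] := leP y pi.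
  by apply: cos_inj; rewrite ?cos0// in_itv/= ?lexx ?(ltW pi0) ?y0.
suff : 2 * pi - y = 0 by rewrite /y in piy *; lra.
apply: cos_inj; rewrite ?cos0 ?in_itv/= ?lexx ?(ltW pi0)//.
  by rewrite /y in piy *; lra.
by rewrite -[RHS]cy -(cosN y) -(cosD2pi (- y)); congr cos; rewrite mulr2n; ring.
Qed.

(** The last coordinate [z / sqrt (1 + z ^+ 2)] determines [z ^+ 2], hence the normalizing factor.
    Then [z], cosine and sine agree, and the longitudes differ by full turns. *)
Lemma sph_inj n a z a' z' : (0 < n)%N -> sph n (pi * a) z = sph n (pi * a') z' ->
  z = z' /\ exists m : int, a - a' = 2 * n%:R * m%:~R.
Proof.
move=> n0 /rowP E; have := E 0; have := E 1; have := E 2%:R; rewrite !mxE /=.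
set s := Num.sqrt _; set s' := Num.sqrt _.
have pos (w : R) : 0 < 1 + w ^+ 2 by rewrite ltr_pwDl// sqr_ge0.
have s0 : 0 < s by rewrite sqrtr_gt0.
have s'0 : 0 < s' by rewrite sqrtr_gt0.
have ss : s ^+ 2 = 1 + z ^+ 2 by rewrite sqr_sqrtr// ltW.
have ss' : s' ^+ 2 = 1 + z' ^+ 2 by rewrite sqr_sqrtr// ltW.
move=> Ez Es Ec.
have Ess : s = s'.
  have Ez2 : z / s = z' / s' by rewrite mulrC Ez mulrC.
  have : (z / s) ^+ 2 = (z' / s') ^+ 2 by rewrite Ez2.
  rewrite !expr_div_n ss ss' => /eqP.
  rewrite eqr_div ?lt0r_neq0// => /eqP Ezz.
  by apply: (@pexpIrn _ 2); rewrite ?nnegrE ?ltW// ss ss'; lra.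
have si : s^-1 != 0 by rewrite invr_eq0 gt_eqF.
move: Ez Es Ec; rewrite -Ess => /(mulfI si) -> /(mulfI si) Es /(mulfI si) Ec.
split=> //.
have : cos (pi * a / n%:R - pi * a' / n%:R) = 1.
  by rewrite cosB Es Ec -!expr2 cos2Dsin2.
move=> /cos_eq1[m Em]; exists m.
have nz : n%:R != 0 :> R by rewrite pnatr_eq0 -lt0n.
have piz : pi != 0 :> R by rewrite gt_eqF// pi_gt0.
apply: (mulfI piz); transitivity (n%:R * (pi * a / n%:R - pi * a' / n%:R)).
  by field.
by rewrite Em; ring.
Qed.

End WheelDrawing.

Section WheelMedial.
Variables (R : realType) (n : nat).
Hypothesis n0 : (0 < n)%N.
Implicit Types t : R.

(** Two indices differ by less than [n], which leaves only [m = 0]. *)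
Lemma ord_eq_mod (i j : 'I_n) (m : int) :
  2 * i%:R - 2 * j%:R = 2 * n%:R * m%:~R :> R -> i = j.
Proof.
move=> E; have {}E : (i%:Z - j%:Z)%:~R = (n%:Z * m)%:~R :> R.
  by rewrite intrB intrM -!pmulrn; lra.
move/intr_inj: E => E; apply: val_inj => /=.
have := ltn_ord i; have := ltn_ord j.
by case: m E => [[|k]|k] E; nia.
Qed.

(** The difference lies in [[-1, 1]], and the values 1 and -1 force one parameter to be 0 and the
    other 1. *)
Lemma int_diff_unit (t u : R) (k : int) : 0 <= t <= 1 -> 0 <= u <= 1 ->
  t - u = k%:~R -> k = 0 \/ (t = 0 \/ t = 1) /\ (u = 0 \/ u = 1).
Proof.
move=> /andP[t0 t1] /andP[u0 u1] E.
have k2 : (k < 2)%R by rewrite -(ltr_int R) -E; lra.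
have kN2 : (- 2 < k)%R by rewrite -(ltr_int R) -E; lra.
have [k0|[k1|k1]] : k = 0 \/ k = 1 \/ k = -1 by lia.
- by left.
- by right; rewrite k1 in E; split; [right|left]; lra.
- by right; rewrite k1 in E; split; [left|right]; lra.
Qed.

(* Longitudes in units of pi / n. *)
Definition med_long (d : dart (wheel n)) t : R :=
  match d with
  | (inl i, false) => 2 * i%:R + 2 * t
  | (inl i, true) => 2 * i%:R - t
  | (inr i, true) => 2 * i%:R + 1 + 2 * t
  | (inr i, false) => 2 * i%:R + 1 - t
  end.

Definition med_height (d : dart (wheel n)) t : R :=
  match d with
  | (inl i, false) => 1 + 4 * t * (1 - t)
  | (inl i, true) => 1 - 2 * t
  | (inr i, true) => - 1 - 4 * t * (1 - t)
  | (inr i, false) => - 1 + 2 * t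
  end.

Lemma wheel_medE d t : wheel_med d t = sph n (pi * med_long d t) (med_height d t).
Proof. by case: d => [[i|i] []] /=; congr sph; ring. Qed.

(** The height, 1 or -1, tells spokes from rim edges, and the longitude gives the index. *)
Lemma med_vertex_inj : injective (med_vertex (@wheel_med n R)).
Proof.
move=> [i|i] [j|j]; rewrite /med_vertex !wheel_medE => /(sph_inj n0)[] /=.
- by move=> _ [m E]; congr inl; apply: (@ord_eq_mod _ _ m); lra.
- by move=> E; exfalso; lra.
- by move=> E; exfalso; lra.
- by move=> _ [m E]; congr inr; apply: (@ord_eq_mod _ _ m); lra.
Qed.

(** Arcs of the upper cycle, the lower cycle and the zigzag can share a height only at 1 or -1,
    hence at ends. Within one of the three families longitudes are compared modulo a full turn. *)
Lemma wheel_med_inj (d d' : dart (wheel n)) t t' :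
  0 <= t <= 1 -> 0 <= t' <= 1 -> wheel_med d t = wheel_med d' t' ->
  (d = d' /\ t = t') \/ ((t = 0 \/ t = 1) /\ (t' = 0 \/ t' = 1)).
Proof.
move=> t01 t'01; rewrite !wheel_medE => /(sph_inj n0)[].
have tt : 0 <= t * (1 - t).
  by move: t01 => /andP[? ?]; rewrite mulr_ge0// subr_ge0.
have tt' : 0 <= t' * (1 - t').
  by move: t'01 => /andP[? ?]; rewrite mulr_ge0// subr_ge0.
have tI : t * (1 - t) = 0 -> t = 0 \/ t = 1.
  by move=> /eqP; rewrite mulf_eq0 subr_eq0 => /orP[] /eqP ->; [left|right].
have tI' : t' * (1 - t') = 0 -> t' = 0 \/ t' = 1.
  by move=> /eqP; rewrite mulf_eq0 subr_eq0 => /orP[] /eqP ->; [left|right].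
(* Consecutive arcs of a cycle are two units of longitude apart, so at a common point their
   parameters differ by an integer. *)
have tr (i j : 'I_n) (m : int) (u u' : R) : 0 <= u <= 1 -> 0 <= u' <= 1 ->
    2 * i%:R - 2 * j%:R + 2 * (u - u') = 2 * n%:R * m%:~R ->
    (i = j /\ u = u') \/ ((u = 0 \/ u = 1) /\ (u' = 0 \/ u' = 1)).
  move=> u01 u'01 E.
  have : u - u' = (n%:Z * m - i%:Z + j%:Z)%:~R.
    by rewrite intrD intrB intrM -!pmulrn; lra.
  move=> /[dup] Eu /(int_diff_unit u01 u'01)[k0|]; last by right.
  rewrite k0 in Eu; left; split; last by lra.
  by apply: (@ord_eq_mod _ _ m); lra.
move: t01 t'01 => /[dup] t01 /andP[t0 t1] /[dup] t'01 /andP[t'0 t'1].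
case: d d' => [[i|i] []] [[j|j] []] /= Ez [m Em].
- by left; split; [congr (inl _, _); apply: (@ord_eq_mod _ _ m)|]; lra.
- by right; split; [left|apply: tI']; lra.
- by right; split; [right|apply: tI']; lra.
(* For zigzag arcs of opposite slope, equal heights give [t + t' = 1], and the longitudes then make
   [t] an integer. *)
- have E : 2 * i%:R - 2 * j%:R + 2 * (0 - t) = 2 * n%:R * m%:~R by lra.
  have [[_ Et]|[_ Et]] := tr i j m 0 t ltac:(lra) t01 E; right.
    by split; [left|right]; lra.
  by split=> //; case: Et => Et; [right|left]; lra.
- by right; split; [apply: tI|left]; lra.
- have E : 2 * i%:R - 2 * j%:R + 2 * (t - t') = 2 * n%:R * m%:~R by lra.
  by have [[-> ->]|] := tr i j m t t' t01 t'01 E; [left|right].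
- by exfalso; lra.
- by right; split; [apply: tI|right]; lra.
- by right; split; [apply: tI|right]; lra.
- by exfalso; lra.
- have E : 2 * i%:R - 2 * j%:R + 2 * (t - t') = 2 * n%:R * m%:~R by lra.
  by have [[-> ->]|] := tr i j m t t' t01 t'01 E; [left|right].
- by right; split; [apply: tI|left]; lra.
- have E : 2 * i%:R - 2 * j%:R + 2 * (1 - t) = 2 * n%:R * m%:~R by lra.
  have [[_ Et]|[_ Et]] := tr i j m 1 t ltac:(lra) t01 E; right.
    by split; [right|left]; lra.
  by split=> //; case: Et => Et; [right|left]; lra.
- by right; split; [right|apply: tI']; lra.
- by right; split; [left|apply: tI']; lra.
- by left; split; [congr (inr _, _); apply: (@ord_eq_mod _ _ m)|]; lra.
Qed.

End WheelMedial.

(** * Extending functions from the diagram to all of space *)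

Section ArcExtension.
Context (R : realType) (V : normedModType R) (D : finType).
Variables (m : D -> R -> V) (F : D -> R -> R).
Hypothesis cm : forall d, {within `[0, 1], continuous (m d)}.
Hypothesis cF : forall d, {within `[0, 1], continuous (F d)}.
Hypothesis mF : forall d d' t t', t \in `[0, 1] -> t' \in `[0, 1] ->
  m d t = m d' t' -> F d t = F d' t'.

(** A closed subset of [[0, 1]] is compact, and so is its image. *)
Lemma arc_image_closed d (A : set R) : closed A ->
  closed (m d @` (`[0, 1] `&` F d @^-1` A)).
Proof.
move=> clA; apply: compact_closed; first exact: norm_hausdorff.
have K01 : `[0, 1] `&` F d @^-1` A `<=` `[0, 1] by move=> t [].
apply: continuous_compact; first exact: (continuous_subspaceW K01 (@cm d)).
apply: (subclosed_compact _ (@segment_compact R 0 1) K01).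
rewrite closed_setSI; last exact: interval_closed.
by move: (@cF d) => /continuous_closedP; apply.
Qed.

Let arcs : set V := \bigcup_(d in setT) m d @` `[0, 1].

(** By [mF] the [F d] glue to one function on the union of the arcs. Preimages of closed sets are
    finite unions of closed pieces of arcs, so it is continuous and Tietze's theorem applies. *)
Lemma arcs_extension : exists g : V -> R,
  [/\ continuous g, exists C : R, forall x, `|g x| <= C &
      forall d t, t \in `[0, 1] -> g (m d t) = F d t].
Proof.
(* The value at a point of the diagram is read off at some chosen parameter; 0 is a default off the
   diagram. *)
pose f (x : V) : R :=
  if pselect (exists dt : D * R, dt.2 \in `[0, 1] /\ m dt.1 dt.2 = x) is left e
  then F (projT1 (cid e)).1 (projT1 (cid e)).2 else 0.
have fE d t : t \in `[0, 1] -> f (m d t) = F d t.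
  move=> t01; rewrite /f; case: pselect => [e|[]]; last by exists (d, t).
  by case: cid => -[d' t'] /= [t'01 E]; exact: mF.
have cl (A : set R) : closed A -> closed (arcs `&` f @^-1` A).
  move=> clA; have -> : arcs `&` f @^-1` A =
      \bigcup_(d in setT) m d @` (`[0, 1] `&` F d @^-1` A).
    apply/seteqP; split=> x.
      move=> [[d _ [t t01 <-]]]; rewrite /= fE// => FA.
      by exists d => //; exists t.
    move=> [d _ [t [t01 FA] <-]]; split; first by exists d => //; exists t.
    by rewrite /= fE.
  apply: closed_bigcup; first exact: finite_finset.
  by move=> d _; exact: arc_image_closed.
have clM : closed arcs by rewrite -[arcs]setIT; exact: (cl setT closedT).
have cf : {within arcs, continuous f}.
  apply/continuous_closedP => A clA; rewrite -closed_setSI//.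
  exact: cl.
have bnd d : exists C : R, 0 <= C /\ forall t, t \in `[0, 1] -> `|F d t| <= C.
  have /compact_bounded := continuous_compact (@cF d) (@segment_compact R 0 1).
  move=> [N [_ FN]]; exists (`|N| + 1); split; first by rewrite addr_ge0.
  move=> t t01; apply: (FN (`|N| + 1)).
    by rewrite ltr_pwDr// ler_norm.
  by exists t.
have [C CF] := choice bnd.
(* The summand 1 makes the bound positive, as the extension theorem requires. *)
have fC x : arcs x -> `|f x| <= 1 + \sum_d C d.
  move=> [d _ [t t01 <-]]; rewrite fE//.
  rewrite (le_trans ((CF d).2 t t01))// (bigD1 d)//= addrCA lerDl.
  by rewrite addr_ge0// sumr_ge0// => i _; exact: (CF i).1.
have C0 : 0 < 1 + \sum_d C d.
  by rewrite ltr_pwDl// sumr_ge0// => i _; exact: (CF i).1.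
have [g [gE cg gC]] :=
  continuous_bounded_extension (@pseudometric_normal R V) clM C0 cf fC.
exists g; split=> //; first by exists (1 + \sum_d C d).
move=> d t t01; rewrite -fE//; apply/esym/gE.
by apply/mem_set; exists d => //; exists t.
Qed.

End ArcExtension.

Section Within.
Context (R : realType) (A : set R).
Implicit Types f g : R -> R.

Lemma within_continuousD f g : {within A, continuous f} ->
  {within A, continuous g} -> {within A, continuous (fun t => f t + g t)}.
Proof.
move=> /subspace_continuousP cf /subspace_continuousP cg.
by apply/subspace_continuousP => x Ax; apply: cvgD; [exact: cf|exact: cg].
Qed.

Lemma within_continuousM f g : {within A, continuous f} ->
  {within A, continuous g} -> {within A, continuous (fun t => f t * g t)}.
Proof.
move=> /subspace_continuousP cf /subspace_continuousP cg.
by apply/subspace_continuousP => x Ax; apply: cvgM; [exact: cf|exact: cg].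
Qed.

Lemma within_continuousN f : {within A, continuous f} ->
  {within A, continuous (fun t => - f t)}.
Proof.
move=> /subspace_continuousP cf.
by apply/subspace_continuousP => x Ax; apply: cvgN; exact: cf.
Qed.

Lemma within_continuous_ln f : (forall x, A x -> 0 < f x) ->
  {within A, continuous f} -> {within A, continuous (fun t => ln (f t))}.
Proof.
move=> f0 /subspace_continuousP cf.
apply/subspace_continuousP => x Ax; apply: continuous_cvg; last exact: cf.
by apply: continuous_ln; exact: f0.
Qed.

End Within.

(** * Continuity of the drawing *)

Section WheelDrawingContinuity.
Variables (R : realType) (n : nat).

Lemma sph_continuous (f g : R -> R) : continuous f -> continuous g ->
  continuous (fun t => sph n (f t) (g t)).
Proof.
move=> cf cg t; apply: (@cvgZ _ _ _ (nbhs t)).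
  apply: (@cvgV _ _ (nbhs t)).
    by rewrite lt0r_neq0// sqrtr_gt0 ltr_pwDl// sqr_ge0.
  apply: (@continuous_cvg _ _ _ (nbhs t)); first exact: sqrt_continuous.
  apply: (@cvgD _ _ _ (nbhs t)); first exact: cvg_cst.
  rewrite expr2; under eq_fun do rewrite expr2.
  by apply: (@cvgM _ _ (nbhs t)); exact: cg.
suff : continuous (fun t =>
    \row_(j < 3) [:: cos (f t / n%:R); sin (f t / n%:R); g t]`_j).
  exact.
apply: continuous_rV => j {}t.
have cfn : f t' / n%:R @[t' --> t] --> f t / n%:R.
  by apply: (@cvgM _ _ (nbhs t)); [exact: cf|exact: cvg_cst].
under eq_fun do rewrite mxE.
case: j => [[|[|[|//]]]] /= _.
- by apply: (@continuous_cvg _ _ _ (nbhs t)); [exact: continuous_cos|exact: cfn].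
- by apply: (@continuous_cvg _ _ _ (nbhs t)); [exact: continuous_sin|exact: cfn].
- exact: cg.
Qed.

Lemma affine_continuous (a b : R) : continuous (fun t : R => a + b * t).
Proof.
move=> t; apply: (@cvgD _ _ _ (nbhs t)); first exact: cvg_cst.
by apply: (@cvgM _ _ (nbhs t)); [exact: cvg_cst|exact: cvg_id].
Qed.

Lemma quadratic_continuous (a b : R) : continuous (fun t : R => a + b * (t * (1 - t))).
Proof.
move=> t; apply: (@cvgD _ _ _ (nbhs t)); first exact: cvg_cst.
apply: (@cvgM _ _ (nbhs t)); first exact: cvg_cst.
apply: (@cvgM _ _ (nbhs t)); first exact: cvg_id.
by apply: (@cvgB _ _ _ (nbhs t)); [exact: cvg_cst|exact: cvg_id].
Qed.

Lemma wheel_med_continuous (d : dart (wheel n)) : continuous (@wheel_med n R d).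
Proof.
have lin (e : dart (wheel n)) (a b a' b' c' : R) :
    (forall t, wheel_med e t =
      sph n (a + b * t) (a' + b' * t + c' * (t * (1 - t)))) ->
    continuous (@wheel_med n R e).
  move=> E; have -> : @wheel_med n R e =
      fun t => sph n (a + b * t) (a' + b' * t + c' * (t * (1 - t))) by exact/funext.
  apply: sph_continuous; first exact: affine_continuous.
  have -> : (fun t : R => a' + b' * t + c' * (t * (1 - t))) =
      (fun t => (a' + b' * t) + (0 + c' * (t * (1 - t)))).
    by apply/funext => t; rewrite add0r.
  move=> t; apply: (@cvgD _ _ _ (nbhs t)); first exact: affine_continuous.
  exact: quadratic_continuous.
case: d => [[i|i] []].
- by apply: (lin _ (2 * pi * i%:R) (- pi) 1 (- 2) 0) => t /=; congr sph; ring.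
- by apply: (lin _ (2 * pi * i%:R) (2 * pi) 1 0 4) => t /=; congr sph; ring.
- by apply: (lin _ (2 * pi * i%:R + pi) (2 * pi) (-1) 0 (- 4)) => t /=; congr sph; ring.
- by apply: (lin _ (2 * pi * i%:R + pi) (- pi) (-1) 2 0) => t /=; congr sph; ring.
Qed.

Lemma wheel_med_sphere (d : dart (wheel n)) (t : R) : sqnorm (wheel_med d t) = 1.
Proof. by case: d => [[i|i] []]; exact: sph_sphere. Qed.

End WheelDrawingContinuity.

(** * Antipodal symmetry of the medial map *)

Section AntipodalWheel.
Variables (R : realType) (n : nat).
Hypothesis n_odd : odd n.
Local Notation med := (@wheel_med n R).
Local Notation vertex := (med_vertex med).

Let n_gt0 : (0 < n)%N. Proof. by case: n n_odd. Qed.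

Lemma wheel_med0 (d : dart (wheel n)) : med d 0 = vertex d.1.
Proof. by case: d => e [] //=; exact: wheel_med_start. Qed.

(** The antipode keeps the parameter of each arc. It therefore sends starts to starts and ends to
    ends, that is, left strands to left strands. *)
Lemma wheel_antipode : exists (dartN : dart (wheel n) -> dart (wheel n))
    (edgeN : edge (wheel n) -> edge (wheel n)),
  [/\ forall d t, - med d t = med (dartN d) t, involutive dartN,
      forall d, (dartN d).1 = edgeN d.1 /\
        (Defs.rot (dartN d)).1 = edgeN (Defs.rot d).1 &
      forall e, vertex (edgeN e) = - vertex e /\ edgeN (edgeN e) = e].
Proof.
have [dartN dartNE] := choice (fun d => @wheel_med_antipodal n R d n_odd).
pose edgeN e := (dartN (e, false)).1.
have edgeNE e : vertex (edgeN e) = - vertex e.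
  by rewrite -[in RHS](wheel_med0 (e, false)) dartNE wheel_med0.
exists dartN, edgeN; split=> //.
(* The midpoint of an arc lies on no other arc, so it identifies the dart. *)
- move=> d; have half : 0 <= (2^-1 : R) <= 1 by lra.
  have E : med (dartN (dartN d)) 2^-1 = med d 2^-1 by rewrite -!dartNE opprK.
  have [[]//|[[Eh|Eh] _]] := wheel_med_inj n_gt0 half half E; exfalso; lra.
- move=> d; split; apply: (@med_vertex_inj R _ n_gt0); rewrite edgeNE.
    by rewrite -wheel_med0 -dartNE wheel_med0.
  by rewrite -wheel_med_end -dartNE wheel_med_end.
- by move=> e; split=> //; apply: (@med_vertex_inj R _ n_gt0); rewrite !edgeNE opprK.
Qed.

(** Distinct arcs meet only at medial vertices, where the value is prescribed by [V]. *)
Lemma arc_function_compat (F : dart (wheel n) -> R -> R) (V : edge (wheel n) -> R) :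
  (forall d, F d 0 = V d.1) -> (forall d, F d 1 = V (Defs.rot d).1) ->
  forall d d' t t', t \in `[0, 1] -> t' \in `[0, 1] ->
  med d t = med d' t' -> F d t = F d' t'.
Proof.
move=> F0 F1 d d' t t' t01 t'01 E.
have ends c s : s = 0 \/ s = 1 -> exists e, med c s = vertex e /\ F c s = V e.
  case=> ->; [exists c.1|exists (Defs.rot c).1]; split=> //.
  - exact: wheel_med0.
  - exact: wheel_med_end.
rewrite !in_itv /= in t01 t'01.
have [[-> ->]//|[/(ends d)[e [Ee ->]] /(ends d')[e' [Ee' ->]]]] :=
  wheel_med_inj n_gt0 t01 t'01 E.
by congr V; apply: (@med_vertex_inj R _ n_gt0); rewrite -Ee -Ee'.
Qed.

Lemma wheel_arcs_extension (F : dart (wheel n) -> R -> R) (V : edge (wheel n) -> R) :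
  (forall d, {within `[0, 1], continuous (F d)}) ->
  (forall d, F d 0 = V d.1) -> (forall d, F d 1 = V (Defs.rot d).1) ->
  exists g : 'rV[R]_3 -> R,
    [/\ continuous g, exists C : R, forall x, `|g x| <= C &
        forall d t, t \in `[0, 1] -> g (med d t) = F d t].
Proof.
move=> cF F0 F1.
have cm d : {within `[0, 1], continuous (med d)}.
  by apply: continuous_subspaceT; exact: wheel_med_continuous.
apply: (@arcs_extension R 'rV[R]_3 _ med F cm cF).
exact: (arc_function_compat F0 F1).
Qed.

End AntipodalWheel.

(** * Radial homeomorphisms of the 3-sphere *)

Section RadialHomeomorphism.
Variable R : realType.

Lemma radial_homeomorphism (a b : 'rV[R]_3 -> R) (Ca Cb : R) :
  continuous a -> continuous b ->
  (forall u, `|a u| <= Ca) -> (forall u, `|b u| <= Cb) ->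
  exists f g : continuousType (S3 R) (S3 R),
    [/\ cancel f g, cancel g f, orientation_preserving f &
        forall p, f p = radial_map a b (p, 1)].
Proof.
move=> ca cb aC bC; pose C := Num.max Ca Cb.
have {}aC u : `|a u| <= C by rewrite le_max aC.
have {}bC u : `|b u| <= C by rewrite le_max bC orbT.
(* These are the coefficients of the inverse affine map on each ray. *)
pose a' u := - a u; pose b' u := - (expR (- a u) * b u).
pose C' := Num.max C (expR C * C).
have cH := radial_map_continuous ca cb aC bC.
have cH' : continuous (radial_map a' b').
  apply: (@radial_map_continuous _ _ _ C').
  - by move=> u; apply: (@cvgN _ _ _ (nbhs u)); exact: ca.
  - move=> u; apply: (@cvgN _ _ _ (nbhs u)).
    apply: (@cvgM _ _ (nbhs u)); last exact: cb.
    apply: (@continuous_cvg _ _ _ (nbhs u)); first exact: continuous_expR.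
    by apply: (@cvgN _ _ _ (nbhs u)); exact: ca.
  - by move=> u; rewrite normrN le_max aC.
  - move=> u; rewrite normrN normrM le_max ler_pM ?orbT// ger0_norm ?expR_ge0//.
    by rewrite ler_expR (le_trans _ (aC u))// -normrN ler_norm.
have c1 (H : S3 R * R -> S3 R) : continuous H -> continuous (fun p => H (p, 1)).
  move=> cHH p; apply: (@continuous_comp _ _ _ (fun p : S3 R => (p, 1 : R)) H).
    have ct : {for p, continuous (fun p : S3 R => 1 : R)}.
      exact: (@cst_continuous _ _ (1 : R) p).
    have cp : {for p, continuous (fun p : S3 R => p)} by exact: cvg_id.
    by apply: (cvg_pair cp ct); exact: nbhs_filter.
  exact: cHH.
exists (mkcts (c1 _ cH)), (mkcts (c1 _ cH')); split=> //.
- apply: radial_map_cancel => u; first by rewrite /a' subrr.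
  by rewrite /b' /a' subrr.
- apply: radial_map_cancel => u; first by rewrite /a' addNr.
  by rewrite /b' mulrN mulrA -expRD subrr expR0 mul1r addNr.
(* The time parameter of the radial map is itself the homotopy from the identity. *)
- by apply: (homotopic_id_orientation_preserving cH) => // p; exact: radial_map0.
Qed.

End RadialHomeomorphism.

(** * Making the log-heights antisymmetric *)

Theorem corollary9 (R : realType) (n : nat) (S : edge (wheel n) -> bool)
    (L : set 'rV[R]_3) :
  (1 <= n)%N -> odd n ->
  (forall v v' : edge (wheel n),
     med_vertex (@wheel_med n R) v' = - med_vertex (@wheel_med n R) v ->
     S v = ~~ S v') ->
  represents S (@wheel_med n R) L ->
  antipodally_symmetric [set stereo x | x in L].
Proof.
move=> _ n_odd SN [l [r [h [ch h0 h_ends lr LE]]]].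
have [dartN [edgeN [dartNE dartNK dartN_edge edgeNE]]] := wheel_antipode R n_odd.
pose a d t := ln (h d t).
pose k d t := (a d t - a (dartN d) t) / 2.
(* These are the log-heights of the left and right strands at a crossing, before and after
   antisymmetrization; [m e] is the logarithm of the slope of the affine map between them. *)
pose al e := ln (l e); pose ar e := ln (r e).
pose kl e := (al e - al (edgeN e)) / 2; pose kr e := (ar e - ar (edgeN e)) / 2.
pose m e := ln ((kl e - kr e) / (al e - ar e)).
have i0 : 0 \in `[0, 1 : R] by rewrite in_itv /= lexx ler01.
have i1 : 1 \in `[0, 1 : R] by rewrite in_itv /= lexx ler01.
have l0 e : 0 < l e by rewrite -(h_ends (e, false)).1 h0.
have r0 e : 0 < r e.
  (* An injection of a finite set is bijective, so some arc ends at [e] and has height [r e]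
     there. *)
  have [g _ gK] := injF_bij (@Defs.rot_inj (wheel n)).
  by have := (h_ends (g (e, false))).2; rewrite gK /= => <-; exact: h0.
have kE e : kl e - kr e = expR (m e) * (al e - ar e).
  have lt_ln (x y : R) : x < y -> 0 < x -> ln x < ln y.
    by move=> xy x0; rewrite ltr_ln ?posrE// (lt_trans x0).
  have Se := SN e (edgeN e) (edgeNE e).1.
  (* At the antipodal crossing the order of left and right is reversed, so the two differences
     entering [kl e - kr e] reinforce each other and keep the sign of [al e - ar e]. *)
  have q0 : 0 < (kl e - kr e) / (al e - ar e).
    have := lr e; have := lr (edgeN e); rewrite Se /kl /kr /al /ar.
    case: (S (edgeN e)) => /= /lt_ln lt1 /lt_ln lt2.
      have {}lt1 := lt1 (r0 _); have {}lt2 := lt2 (l0 _).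
      by rewrite -mulrNN -invrN divr_gt0//; lra.
    have {}lt1 := lt1 (l0 _); have {}lt2 := lt2 (r0 _).
    by rewrite divr_gt0//; lra.
  rewrite /m lnK ?posrE// mulfVK//.
  by apply: contraTN q0 => /eqP ->; rewrite invr0 mulr0 ltxx.
have ca d : {within `[0, 1], continuous (a d)}.
  by apply: within_continuous_ln => [t t01|]; [exact: h0|exact: ch].
have ck d : {within `[0, 1], continuous (k d)}.
  apply: within_continuousM; last by apply: continuous_subspaceT => t; exact: cvg_cst.
  by apply: within_continuousD; [exact: ca|apply: within_continuousN; exact: ca].
(* The log-slope is interpolated linearly between crossings, and [B] is then determined by
   [expR A * a + B = k]. *)
pose A (d : dart (wheel n)) t := m d.1 + (m (Defs.rot d).1 - m d.1) * t.
have cA d : continuous (A d) by exact: affine_continuous.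
pose B d t := k d t - expR (A d t) * a d t.
have cB d : {within `[0, 1], continuous (B d)}.
  apply: within_continuousD; first exact: ck.
  apply: within_continuousN; apply: within_continuousM; last exact: ca.
  apply: continuous_subspaceT => t; apply: (@continuous_cvg _ _ _ (nbhs t)).
    exact: continuous_expR.
  exact: cA.
have A0 d : A d 0 = m d.1 by rewrite /A mulr0 addr0.
have A1 d : A d 1 = m (Defs.rot d).1 by rewrite /A mulr1 addrC subrK.
(* By the choice of m, the left and the right strand give the same value of B at
   a crossing. *)
pose V e := kl e - expR (m e) * al e.
have B0 d : B d 0 = V d.1.
  by rewrite /B A0 /k /a !(h_ends _).1 (dartN_edge d).1.
have B1 d : B d 1 = V (Defs.rot d).1.
  rewrite /B A1 /k /a !(h_ends _).2 (dartN_edge d).2 -/(ar _) -/(ar _) -/(kr _).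
  by have := kE (Defs.rot d).1; rewrite /V; lra.
have [gA [cgA [CA gA_le] gAE]] :=
  wheel_arcs_extension n_odd (fun d => continuous_subspaceT (cA d)) A0 A1.
have [gB [cgB [CB gB_le] gBE]] := wheel_arcs_extension n_odd cB B0 B1.
have [f [g [fK gK f_or fE]]] := radial_homeomorphism cgA cgB gA_le gB_le.
exists (f @` [set stereo x | x in L]); first by exists f, g.
(* Over the diagram, [f] changes the log-height from [a] to [k]. *)
have f_arc d t : t \in `[0, 1] ->
    f (stereo (h d t *: wheel_med d t)) = stereo (expR (k d t) *: wheel_med d t).
  move=> t01; have u1 := @wheel_med_sphere R n d t.
  rewrite fE -[h d t]lnK ?posrE ?h0// radial_map_polar// !mul1r gAE// gBE//.
  by rewrite /B addrC subrK.
have anti_sub : @antipode R @` (f @` [set stereo x | x in L]) `<=`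
    f @` [set stereo x | x in L].
  move=> _ [_ [_ [x + <-] <-] <-]; rewrite LE => -[d [t [t01 ->]]].
  rewrite f_arc// antipode_polar ?wheel_med_sphere// dartNE.
  have -> : - k d t = k (dartN d) t by rewrite /k dartNK; lra.
  rewrite -f_arc//; exists (stereo (h (dartN d) t *: wheel_med (dartN d) t)) => //.
  exists (h (dartN d) t *: wheel_med (dartN d) t) => //.
  by exists (dartN d), t.
(* The antipode is an involution, so one inclusion gives the other. *)
apply/seteqP; split=> // p Lp; exists (antipode p); last exact: antipodeK.
by apply: anti_sub; exists p.
Qed.
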